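(* The Koszul dual operad $\mathcal{Q}uad^!=\mathcal{D}ias\,\square\,\mathcal{D}ias$ of $\mathcal{Q}uad=\mathcal{D}end\,\blacksquare\,\mathcal{D}end$ is isomorphic to the Hadamard product $\mathcal{P}erm\otimes\mathcal{D}ias=\mathcal{P}erm\otimes\mathcal{P}erm\otimes\mathcal{A}s$.
   Context: The ground field $k$ has characteristic $0$. A non-symmetric operad $\{\mathcal{P}'_n\}_{n\ge1}$ is an operad without symmetric group actions; $\Sigma$ associates to it the operad $\mathcal{P}(n)=\mathcal{P}'_n\otimes k[\mathbb{S}_n]$, called a regular operad. A binary quadratic regular operad is $\Sigma(\mathcal{F}(V')/(R'))$, with $V'$ a finite dimensional space in arity $2$, $\mathcal{F}(V')$ the free non-symmetric operad, and $R'\subset\mathcal{F}(V')(3)$, spanned by $\mu\circ_1\nu=\mu(\nu(x,y),z)$ and $\mu\circ_2\nu=\mu(x,\nu(y,z))$. Koszul dual: $\mathcal{P}^!=\Sigma(\mathcal{F}(V'^* )/(R'^\perp))$ for the pairing $\langle\mu\circ_1\nu,\zeta\circ_1\xi\rangle=\zeta(\mu)\xi(\nu)$, $\langle\mu\circ_2\nu,\zeta\circ_2\xi\rangle=-\zeta(\mu)\xi(\nu)$, others zero. For $\mathcal{P}=\Sigma(\mathcal{F}(V')/(R'))$ and $\mathcal{Q}=\Sigma(\mathcal{F}(W')/(S'))$, $$\mathcal{P}\,\square\,\mathcal{Q}=\Sigma\Big(\mathcal{F}(V'\otimes W')/\big(\Phi^{-1}(R'\otimes\mathcal{F}(W')(3)+\mathcal{F}(V')(3)\otimes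 S')\big)\Big),\qquad \mathcal{P}\,\blacksquare\,\mathcal{Q}=\Sigma\big(\mathcal{F}(V'\otimes W')/(\Psi(R'\otimes S'))\big),$$ with $\Phi((\mu\otimes\mu')\circ_i(\nu\otimes\nu'))=(\mu\circ_i\nu)\otimes(\mu'\circ_i\nu')$ and $\Psi((\mu\circ_i\nu)\otimes(\mu'\circ_j\nu'))=\delta_{ij}(-1)^{i-1}(\mu\otimes\mu')\circ_i(\nu\otimes\nu')$. $\mathcal{D}end$ (dendriform): operations $\prec,\succ$ with $(x\prec y)\prec z=x\prec(y\prec z)+x\prec(y\succ z)$, $(x\succ y)\prec z=x\succ(y\prec z)$, $(x\prec y)\succ z+(x\succ y)\succ z=x\succ(y\succ z)$. $\mathcal{D}ias=\mathcal{D}end^!$: operations $\dashv,\vdash$ with $(x\dashv y)\dashv z=x\dashv(y\dashv z)=x\dashv(y\vdash z)$, $(x\vdash y)\dashv z=x\vdash(y\dashv z)$, $(x\dashv y)\vdash z=(x\vdash y)\vdash z=x\vdash(y\vdash z)$. $\mathcal{P}erm$: one operation with $(xy)z=x(yz)=x(zy)$; $\mathcal{P}erm(n)$ has basis $e^n_1,\dots,e^n_n$ with composition $e^l_i(e^{m_1}_{j_1},\dots,e^{m_l}_{j_l})=e^{m_1+\cdots+m_l}_{m_1+\cdots+m_{i-1}+j_i}$. $\mathcal{A}s$ is the operad of associative algebras. The Hadamard product is $(\mathcal{P}\otimes\mathcal{Q})(n)=\mathcal{P}(n)\otimes\mathcal{Q}(n)$ with diagonal symmetric group action and componentwise composition.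 *)

(* Defs.v *)
From HB Require Import structures.
From mathcomp Require Import all_boot all_order all_algebra all_fingroup.
From mathcomp Require Import boolp zify.

Set Implicit Arguments.
Unset Strict Implicit.
Unset Printing Implicit Defensive.

Import GRing.Theory.
Local Open Scope ring_scope.
Local Open Scope quotient_scope.

Section QuotientModule.
Variables (k : fieldType) (V : lmodType k).

Definition submodule (J : V -> Prop) : Prop :=
  J 0 /\ forall (c : k) x y, J x -> J y -> J (c *: x + y).

Variables (J : V -> Prop) (subJ : submodule J).

Let J0 : J 0. Proof. by case: subJ. Qed.
Let JD x y : J x -> J y -> J (x + y).
Proof. by move=> Jx Jy; rewrite -[x]scale1r; apply: subJ.2. Qed.
Let JZ c x : J x -> J (c *: x).
Proof. by move=> Jx; rewrite -[_ *: _]addr0; apply: subJ.2. Qed.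
Let JN x : J x -> J (- x).
Proof. by rewrite -scaleN1r; apply: JZ. Qed.

Definition quot_rel : rel V := fun x y => `[< J (x - y) >].

Lemma quot_rel_refl : reflexive quot_rel.
Proof. by move=> x; apply/asboolP; rewrite subrr. Qed.
Lemma quot_rel_sym : symmetric quot_rel.
Proof.
by move=> x y; apply/asboolP/asboolP => /JN; rewrite opprB.
Qed.
Lemma quot_rel_trans : transitive quot_rel.
Proof.
move=> y x z /asboolP Jxy /asboolP Jyz; apply/asboolP.
by rewrite -(subrKA y); apply: JD.
Qed.

Canonical quot_equiv := EquivRel quot_rel quot_rel_refl quot_rel_sym quot_rel_trans.

Definition quot : Type := {eq_quot quot_equiv}.
HB.instance Definition _ := Choice.on quot.

Definition qpi (x : V) : quot := \pi_{eq_quot quot_equiv} x.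
Definition qrepr (q : quot) : V := generic_quotient.repr (q : {eq_quot quot_equiv}).

Lemma qreprK : cancel qrepr qpi.
Proof. exact: reprK. Qed.

Lemma qpi_eq x y : qpi x = qpi y <-> J (x - y).
Proof.
split; first by move/eqmodP => /asboolP.
by move=> Jxy; apply/eqmodP/asboolP.
Qed.

Lemma qpi_ind (P : quot -> Prop) : (forall x, P (qpi x)) -> forall q, P q.
Proof. by move=> H q; rewrite -[q]qreprK. Qed.

Lemma qrepr_pi x : J (qrepr (qpi x) - x).
Proof. by apply/qpi_eq; rewrite qreprK. Qed.

Definition quot_zero := qpi 0.
Definition quot_opp q := qpi (- qrepr q).
Definition quot_add q r := qpi (qrepr q + qrepr r).
Definition quot_scale (c : k) q := qpi (c *: qrepr q).

Lemma quot_addE x y : quot_add (qpi x) (qpi y) = qpi (x + y).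
Proof.
by apply/qpi_eq; rewrite opprD addrACA; apply: JD; apply: qrepr_pi.
Qed.
Lemma quot_oppE x : quot_opp (qpi x) = qpi (- x).
Proof. by apply/qpi_eq; rewrite -opprD; apply/JN/qrepr_pi. Qed.
Lemma quot_scaleE c x : quot_scale c (qpi x) = qpi (c *: x).
Proof. by apply/qpi_eq; rewrite -scalerBr; apply/JZ/qrepr_pi. Qed.

Fact quot_addA : associative quot_add.
Proof.
elim/qpi_ind=> x; elim/qpi_ind=> y; elim/qpi_ind=> z.
by rewrite !quot_addE addrA.
Qed.
Fact quot_addC : commutative quot_add.
Proof. by elim/qpi_ind=> x; elim/qpi_ind=> y; rewrite !quot_addE addrC. Qed.
Fact quot_add0 : left_id quot_zero quot_add.
Proof. by elim/qpi_ind=> x; rewrite quot_addE add0r. Qed.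
Fact quot_addN : left_inverse quot_zero quot_opp quot_add.
Proof. by elim/qpi_ind=> x; rewrite quot_oppE quot_addE addNr. Qed.
HB.instance Definition _ :=
  GRing.isZmodule.Build quot quot_addA quot_addC quot_add0 quot_addN.

Fact quot_scaleA a b q : quot_scale a (quot_scale b q) = quot_scale (a * b) q.
Proof. by elim/qpi_ind: q => x; rewrite !quot_scaleE scalerA. Qed.
Fact quot_scale1 : left_id 1 quot_scale.
Proof. by elim/qpi_ind=> x; rewrite quot_scaleE scale1r. Qed.
Fact quot_scaleDr : right_distributive quot_scale +%R.
Proof.
move=> c; elim/qpi_ind=> x; elim/qpi_ind=> y.
by rewrite [qpi x + _]quot_addE !quot_scaleE scalerDr [RHS]quot_addE.
Qed.
Fact quot_scaleDl q : {morph quot_scale^~ q : a b / a + b}.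
Proof.
elim/qpi_ind: q => x a b; rewrite !quot_scaleE.
by rewrite scalerDl [RHS]quot_addE.
Qed.
HB.instance Definition _ :=
  GRing.Zmodule_isLmodule.Build k quot
    quot_scaleA quot_scale1 quot_scaleDr quot_scaleDl.

Fact qpi_is_linear : linear qpi.
Proof.
by move=> c x y; rewrite -quot_addE -quot_scaleE.
Qed.
HB.instance Definition _ := GRing.isLinear.Build k V quot _ qpi qpi_is_linear.

End QuotientModule.

Section Tensor.
Variables (k : fieldType) (M N : lmodType k).

Definition bilinear_map (L : lmodType k) (f : M -> N -> L) : Prop :=
  (forall y, linear (f^~ y)) /\ (forall x, linear (f x)).

Definition fsum_eval (L : lmodType k) (f : M -> N -> L) (s : seq (M * N)) : L :=
  \sum_(p <- s) f p.1 p.2.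

(* A tensor is a formal sum of pairs (x, y), standing for the sum of the pure
   tensors x (x) y; two formal sums are identified when every bilinear map
   takes the same value on them. *)
Definition tensor_rel : rel (seq (M * N)) := fun s t =>
  `[< forall (L : lmodType k) (f : M -> N -> L), bilinear_map f ->
        fsum_eval f s = fsum_eval f t >].

Lemma tensor_rel_refl : reflexive tensor_rel.
Proof. by move=> s; apply/asboolP. Qed.
Lemma tensor_rel_sym : symmetric tensor_rel.
Proof. by move=> s t; apply/asboolP/asboolP => st L f /st ->. Qed.
Lemma tensor_rel_trans : transitive tensor_rel.
Proof.
move=> t s u /asboolP st /asboolP tu; apply/asboolP => L f bf.
by rewrite st // tu.
Qed.

Canonical tensor_equiv :=
  EquivRel tensor_rel tensor_rel_refl tensor_rel_sym tensor_rel_trans.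

Definition tensor : Type := {eq_quot tensor_equiv}.
HB.instance Definition _ := Choice.on tensor.

Definition tpi (s : seq (M * N)) : tensor := \pi_{eq_quot tensor_equiv} s.
Definition trepr (u : tensor) : seq (M * N) :=
  generic_quotient.repr (u : {eq_quot tensor_equiv}).
Lemma treprK : cancel trepr tpi.
Proof. exact: reprK. Qed.

Lemma tpi_eq s t : tpi s = tpi t <->
  forall (L : lmodType k) (f : M -> N -> L), bilinear_map f ->
    fsum_eval f s = fsum_eval f t.
Proof.
split; first by move/eqmodP => /asboolP.
by move=> st; apply/eqmodP/asboolP.
Qed.

Lemma tpi_ind (P : tensor -> Prop) : (forall s, P (tpi s)) -> forall u, P u.
Proof. by move=> H u; rewrite -[u]treprK. Qed.

Definition tlift (L : lmodType k) (f : M -> N -> L) (u : tensor) : L :=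
  fsum_eval f (trepr u).

Section Eval.
Variables (L : lmodType k) (f : M -> N -> L) (bf : bilinear_map f).

Lemma tliftE s : tlift f (tpi s) = fsum_eval f s.
Proof. by have/tpi_eq e := treprK (tpi s); apply: e. Qed.

Lemma bilinear_mapDl x y z : f (x + y) z = f x z + f y z.
Proof. by have := bf.1 z 1 x y; rewrite /= !scale1r. Qed.
Lemma bilinear_mapDr x y z : f x (y + z) = f x y + f x z.
Proof. by have := bf.2 x 1 y z; rewrite /= !scale1r. Qed.
Lemma bilinear_map0l y : f 0 y = 0.
Proof. by apply: (addrI (f 0 y)); rewrite -bilinear_mapDl !addr0. Qed.
Lemma bilinear_map0r x : f x 0 = 0.
Proof. by apply: (addrI (f x 0)); rewrite -bilinear_mapDr !addr0. Qed.
Lemma bilinear_mapZl c x y : f (c *: x) y = c *: f x y.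
Proof. by have := bf.1 y c x 0; rewrite /= !addr0 bilinear_map0l addr0. Qed.
Lemma bilinear_mapZr c x y : f x (c *: y) = c *: f x y.
Proof. by have := bf.2 x c y 0; rewrite /= !addr0 bilinear_map0r addr0. Qed.
Lemma bilinear_mapNl x y : f (- x) y = - f x y.
Proof. by rewrite -scaleN1r bilinear_mapZl scaleN1r. Qed.
Lemma bilinear_mapNr x y : f x (- y) = - f x y.
Proof. by rewrite -scaleN1r bilinear_mapZr scaleN1r. Qed.

Lemma fsum_eval_cat s t : fsum_eval f (s ++ t) = fsum_eval f s + fsum_eval f t.
Proof. by rewrite /fsum_eval big_cat. Qed.
Lemma fsum_eval_scale c s :
  fsum_eval f [seq (c *: p.1, p.2) | p <- s] = c *: fsum_eval f s.
Proof.
rewrite /fsum_eval big_map scaler_sumr.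
by apply: eq_bigr => p _; rewrite bilinear_mapZl.
Qed.
End Eval.

Definition tensor_zero := tpi [::].
Definition tensor_add u v := tpi (trepr u ++ trepr v).
Definition tensor_scale (c : k) u := tpi [seq (c *: p.1, p.2) | p <- trepr u].
Definition tensor_opp u := tensor_scale (-1) u.

Lemma tensor_addE s t : tensor_add (tpi s) (tpi t) = tpi (s ++ t).
Proof.
apply/tpi_eq => L f bf; rewrite !fsum_eval_cat.
by rewrite -!/(tlift _ _) !tliftE.
Qed.
Lemma tensor_scaleE c s :
  tensor_scale c (tpi s) = tpi [seq (c *: p.1, p.2) | p <- s].
Proof.
apply/tpi_eq => L f bf; rewrite !fsum_eval_scale //.
by rewrite -!/(tlift _ _) !tliftE.
Qed.

Fact tensor_addA : associative tensor_add.
Proof.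
elim/tpi_ind=> x; elim/tpi_ind=> y; elim/tpi_ind=> z.
by rewrite !tensor_addE catA.
Qed.
Fact tensor_addC : commutative tensor_add.
Proof.
elim/tpi_ind=> x; elim/tpi_ind=> y; rewrite !tensor_addE.
by apply/tpi_eq => L f bf; rewrite !fsum_eval_cat addrC.
Qed.
Fact tensor_add0 : left_id tensor_zero tensor_add.
Proof. by elim/tpi_ind=> x; rewrite tensor_addE. Qed.
Fact tensor_addN : left_inverse tensor_zero tensor_opp tensor_add.
Proof.
elim/tpi_ind=> x; rewrite /tensor_opp tensor_scaleE tensor_addE.
apply/tpi_eq => L f bf; rewrite fsum_eval_cat fsum_eval_scale //.
by rewrite scaleN1r addNr /fsum_eval big_nil.
Qed.
HB.instance Definition _ :=
  GRing.isZmodule.Build tensor tensor_addA tensor_addC tensor_add0 tensor_addN.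

Fact tensor_scaleA a b u :
  tensor_scale a (tensor_scale b u) = tensor_scale (a * b) u.
Proof.
elim/tpi_ind: u => x; rewrite !tensor_scaleE.
by apply/tpi_eq => L f bf; rewrite !fsum_eval_scale // scalerA.
Qed.
Fact tensor_scale1 : left_id 1 tensor_scale.
Proof.
elim/tpi_ind=> x; rewrite !tensor_scaleE.
by apply/tpi_eq => L f bf; rewrite !fsum_eval_scale // scale1r.
Qed.
Fact tensor_scaleDr : right_distributive tensor_scale +%R.
Proof.
move=> c; elim/tpi_ind=> x; elim/tpi_ind=> y.
rewrite [tpi x + tpi y]tensor_addE !tensor_scaleE.
rewrite [RHS]tensor_addE; apply/tpi_eq => L f bf.
by rewrite !(fsum_eval_scale, fsum_eval_cat) // scalerDr.
Qed.
Fact tensor_scaleDl u : {morph tensor_scale^~ u : a b / a + b}.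
Proof.
elim/tpi_ind: u => x a b; rewrite !tensor_scaleE.
rewrite [RHS]tensor_addE; apply/tpi_eq => L f bf.
by rewrite !(fsum_eval_scale, fsum_eval_cat) // scalerDl.
Qed.
HB.instance Definition _ :=
  GRing.Zmodule_isLmodule.Build k tensor
    tensor_scaleA tensor_scale1 tensor_scaleDr tensor_scaleDl.

Definition tpure (x : M) (y : N) : tensor := tpi [:: (x, y)].

Fact tpure_bilinear : bilinear_map tpure.
Proof.
split=> [y c x x' | x c y y'].
- transitivity (tensor_add (tensor_scale c (tpure x y)) (tpure x' y)) => //.
  rewrite tensor_scaleE tensor_addE; apply/tpi_eq => L f bf.
  rewrite fsum_eval_cat /fsum_eval !big_cons !big_nil !addr0 /=.
  by rewrite (bilinear_mapDl bf).
- transitivity (tensor_add (tensor_scale c (tpure x y)) (tpure x y')) => //.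
  rewrite tensor_scaleE tensor_addE; apply/tpi_eq => L f bf.
  rewrite fsum_eval_cat /fsum_eval !big_cons !big_nil !addr0 /=.
  by rewrite (bilinear_mapDr bf) (bilinear_mapZr bf) (bilinear_mapZl bf).
Qed.

Lemma tpi_sum s : tpi s = \sum_(p <- s) tpure p.1 p.2.
Proof.
elim: s => [|p s IHs]; first by rewrite big_nil.
by rewrite big_cons -IHs [RHS]tensor_addE; case: p.
Qed.

Lemma tensor_ind (P : tensor -> Prop) :
  P 0 -> (forall u v, P u -> P v -> P (u + v)) ->
  (forall x y, P (tpure x y)) -> forall u, P u.
Proof.
move=> P0 PD P1; elim/tpi_ind => s; rewrite tpi_sum.
by elim/big_ind: _ => // p _; apply: P1.
Qed.

Lemma tlift_pure (L : lmodType k) (f : M -> N -> L) x y :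
  bilinear_map f -> tlift f (tpure x y) = f x y.
Proof. by move=> bf; rewrite tliftE // /fsum_eval big_seq1. Qed.

Lemma tlift_linear (L : lmodType k) (f : M -> N -> L) :
  bilinear_map f -> linear (tlift f).
Proof.
move=> bf c; elim/tpi_ind=> s; elim/tpi_ind=> t.
rewrite -[c *: tpi s]/(tensor_scale c (tpi s)) tensor_scaleE.
by rewrite [tpi _ + _]tensor_addE !tliftE // fsum_eval_cat fsum_eval_scale.
Qed.

Lemma tensor_ext (L : lmodType k) (f g : tensor -> L) :
  linear f -> linear g -> (forall x y, f (tpure x y) = g (tpure x y)) ->
  f =1 g.
Proof.
move=> lf lg fg.
have D (h : tensor -> L) : linear h -> h 0 = 0 /\ {morph h : x y / x + y}.
  move=> lh; have hD : {morph h : x y / x + y}.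
    by move=> x y; have := lh 1 x y; rewrite !scale1r.
  by split=> //; apply: (addrI (h 0)); rewrite -hD !addr0.
have [[f0 fD] [g0 gD]] := (D _ lf, D _ lg).
by apply: tensor_ind => [|u v fgu fgv|//]; rewrite ?f0 ?g0 // fD gD fgu fgv.
Qed.

End Tensor.
Local Ltac slot_cases :=
  repeat match goal with |- context [if ?b then _ else _] =>
    lazymatch b with
    | context [if _ then _ else _] => fail
    | _ => let h := fresh in case: (boolP b) => h
    end
  end.

Section Slots.
Implicit Types m n p : nat.

(* Input slots of a partial composite  a o_i b  with a of arity m+1, b of arity
   n+1 (so of arity m+n+1): [slot i l j] is the position in the composite of
   input l of a if l != i, and of input j of b if l = i. *)
Definition slot m n p (i l : 'I_m.+1) (j : 'I_n.+1) : 'I_p.+1 :=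
  inord (if l == i then i + j else if (l < i)%N then nat_of_ord l else l + n)%N.

Definition slot_outer m n p (i : 'I_m.+1) (x : 'I_p.+1) : 'I_m.+1 :=
  inord (if (x < i)%N then nat_of_ord x else if (x <= i + n)%N then nat_of_ord i else x - n)%N.

Definition slot_inner m n p (i : 'I_m.+1) (x : 'I_p.+1) : 'I_n.+1 :=
  inord (x - i).

Lemma slotE m n p (e : (m + n)%N = p) (i l : 'I_m.+1) (j : 'I_n.+1) :
  slot p i l j = (if l == i then i + j else if (l < i)%N then nat_of_ord l else l + n)%N
    :> nat.
Proof.
rewrite inordK //; have := ltn_ord i; have := ltn_ord l; have := ltn_ord j => hj hl hi.
by rewrite -val_eqE /=; slot_cases; lia.
Qed.

Lemma slotK_outer m n p (e : (m + n)%N = p) (i l : 'I_m.+1) (j : 'I_n.+1) :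
  slot_outer n i (slot p i l j) = l.
Proof.
apply/val_inj; rewrite /slot_outer slotE //= -val_eqE /=.
have := ltn_ord i; have := ltn_ord l; have := ltn_ord j => hj hl hi.
by rewrite inordK; slot_cases; lia.
Qed.

Lemma slotK_inner m n p (e : (m + n)%N = p) (i : 'I_m.+1) (j : 'I_n.+1) :
  slot_inner n i (slot p i i j) = j.
Proof.
by apply/val_inj; rewrite /slot_inner slotE // eqxx addKn /= inordK.
Qed.

Lemma slot_neq m n p (i l : 'I_m.+1) (j j' : 'I_n.+1) :
  l != i -> slot p i l j = slot p i l j'.
Proof. by rewrite /slot => /negbTE ->. Qed.

Lemma slotK m n p (e : (m + n)%N = p) (i : 'I_m.+1) (x : 'I_p.+1) :
  slot p i (slot_outer n i x) (slot_inner n i x) = x.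
Proof.
apply/val_inj; rewrite /= slotE // -val_eqE /=.
have := ltn_ord i; have := ltn_ord x => hx hi.
rewrite /slot_outer /slot_inner.
rewrite inordK; last by slot_cases; lia.
have [xi|/eqP xi] := eqP; last by move: xi; slot_cases; lia.
by rewrite inordK; move: xi; slot_cases; lia.
Qed.

Lemma slot_ext m n p (e : (m + n)%N = p) (i : 'I_m.+1) (T : Type)
    (f g : 'I_p.+1 -> T) :
  (forall l (j : 'I_n.+1), f (slot p i l j) = g (slot p i l j)) -> f =1 g.
Proof. by move=> fg x; rewrite -(slotK e i x). Qed.

Lemma slot_seq m n p q r s (e1 : (m + n)%N = p) (e2 : (p + q)%N = r)
    (e3 : (n + q)%N = s) (e4 : (m + s)%N = r)
    (i l : 'I_m.+1) (j y : 'I_n.+1) (z : 'I_q.+1) :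
  slot r (slot p i i j) (slot p i l y) z = slot r i l (slot s j y z).
Proof.
apply/val_inj; rewrite /= !slotE // -!val_eqE /= !slotE // -?val_eqE /= eqxx.
have := ltn_ord i; have := ltn_ord l; have := ltn_ord j; have := ltn_ord y.
have := ltn_ord z => hz hy hj hl hi.
by slot_cases; lia.
Qed.

Lemma slot_par m n p q r s (e1 : (m + n)%N = p) (e2 : (p + q)%N = r)
    (e3 : (m + q)%N = s) (e4 : (s + n)%N = r)
    (i i' l : 'I_m.+1) (j y : 'I_n.+1) (z w : 'I_q.+1) :
  i != i' ->
  slot r (slot p i i' j) (slot p i l y) z =
  slot r (slot s i' i w) (slot s i' l z) y.
Proof.
rewrite -val_eqE /= => ne.
apply/val_inj; rewrite /= !slotE // -!val_eqE /= !slotE // -!val_eqE /=.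
have := ltn_ord i; have := ltn_ord l; have := ltn_ord j; have := ltn_ord y.
have := ltn_ord z; have := ltn_ord i'; have := ltn_ord w.
move=> hw hi' hz hy hj hl hi.
by slot_cases; lia.
Qed.

Section PermComp.
Variables (m n p : nat) (e : (m + n)%N = p).
Variables (i : 'I_m.+1) (s : 'S_m.+1) (t : 'S_n.+1).

Definition perm_comp_fun (x : 'I_p.+1) : 'I_p.+1 :=
  slot p (s i) (s (slot_outer n i x)) (t (slot_inner n i x)).

Fact perm_comp_inj : injective perm_comp_fun.
Proof.
move=> x y; rewrite /perm_comp_fun => exy.
have := congr1 (slot_outer n (s i)) exy.
rewrite !slotK_outer // => /perm_inj exy1.
rewrite -(slotK e i x) -(slotK e i y) exy1.
have [yi|?] := eqVneq (slot_outer n i y) i; last exact: slot_neq.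
rewrite yi; move: exy; rewrite exy1 yi => /(congr1 (slot_inner n (s i))).
by rewrite !slotK_inner // => /perm_inj ->.
Qed.

Definition perm_comp : 'S_p.+1 := perm perm_comp_inj.

Lemma perm_compE l j :
  perm_comp (slot p i l j) = slot p (s i) (s l) (t j).
Proof.
rewrite permE /perm_comp_fun slotK_outer //.
have [->|ne] := eqVneq l i; first by rewrite slotK_inner.
by apply: slot_neq; rewrite (inj_eq perm_inj).
Qed.

End PermComp.

End Slots.

Section Operads.
Variable k : fieldType.

(* The component [opc P n] is the space of operations of arity n+1; inputs are
   numbered from 0.  Operads are presented by their partial compositions
   a o_i b, substituting b in input i of a.  Carrying the equation m + n = p
   avoids transports in the axioms. *)
Record nsoperad := NsOperad {
  opc :> nat -> lmodType k;
  op_id : opc 0;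
  op_comp : forall m n p, (m + n)%N = p -> 'I_m.+1 -> opc m -> opc n -> opc p;
  op_comp_bilinear : forall m n p (e : (m + n)%N = p) i,
    bilinear_map (op_comp e i);
  op_compA : forall m n p q r s (e1 : (m + n)%N = p) (e2 : (p + q)%N = r)
      (e3 : (n + q)%N = s) (e4 : (m + s)%N = r)
      (i : 'I_m.+1) (j : 'I_n.+1) (l : 'I_p.+1) a b c,
    l = (i + j)%N :> nat ->
    op_comp e2 l (op_comp e1 i a b) c = op_comp e4 i a (op_comp e3 j b c);
  op_compC : forall m n p q r s (e1 : (m + n)%N = p) (e2 : (p + q)%N = r)
      (e3 : (m + q)%N = s) (e4 : (s + n)%N = r)
      (i i' : 'I_m.+1) (l : 'I_p.+1) (l' : 'I_s.+1) a b c,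
    (i < i')%N -> l = (i' + n)%N :> nat -> l' = i :> nat ->
    op_comp e2 l (op_comp e1 i a b) c = op_comp e4 l' (op_comp e3 i' a c) b;
  op_id_comp : forall n (e : (0 + n)%N = n) i a, op_comp e i op_id a = a;
  op_comp_id : forall n (e : (n + 0)%N = n) i a, op_comp e i a op_id = a
}.

Section NsTheory.
Variable P : nsoperad.

Lemma op_compA_slot m n p q r s (e1 : (m + n)%N = p) (e2 : (p + q)%N = r)
    (e3 : (n + q)%N = s) (e4 : (m + s)%N = r) (i : 'I_m.+1) (j : 'I_n.+1)
    (a : P m) (b : P n) (c : P q) :
  op_comp e2 (slot p i i j) (op_comp e1 i a b) c =
  op_comp e4 i a (op_comp e3 j b c).
Proof. by apply: op_compA; rewrite slotE // eqxx. Qed.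

Lemma op_compC_slot m n p q r s (e1 : (m + n)%N = p) (e2 : (p + q)%N = r)
    (e3 : (m + q)%N = s) (e4 : (s + n)%N = r)
    (i i' : 'I_m.+1) (j : 'I_n.+1) (w : 'I_q.+1) (a : P m) (b : P n) (c : P q) :
  i != i' ->
  op_comp e2 (slot p i i' j) (op_comp e1 i a b) c =
  op_comp e4 (slot s i' i w) (op_comp e3 i' a c) b.
Proof.
move=> ne; move: (ne); rewrite -val_eqE /= neq_ltn => /orP[lt|lt].
  by apply: op_compC => //; rewrite slotE // -val_eqE /=; slot_cases; lia.
symmetry.
by apply: op_compC => //; rewrite slotE // -val_eqE /=; slot_cases; lia.
Qed.

End NsTheory.

(* [op_act a s] is a with inputs relabelled: input i becomes input s i.  As the
   product of permutations is (s * t) i = t (s i), this is a right action. *)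
Record operad := Operad {
  op_ns :> nsoperad;
  op_act : forall n, op_ns n -> 'S_n.+1 -> op_ns n;
  op_act_linear : forall n s, linear (fun a => @op_act n a s);
  op_act1 : forall n a, @op_act n a 1%g = a;
  op_actM : forall n a (s t : 'S_n.+1), @op_act n a (s * t)%g = op_act (op_act a s) t;
  op_act_comp : forall m n p (e : (m + n)%N = p) (i : 'I_m.+1)
      a b (s : 'S_m.+1) (t : 'S_n.+1),
    op_comp e (s i) (op_act a s) (op_act b t) =
    op_act (op_comp e i a b) (perm_comp e i s t)
}.

Definition operad_isomorphic (P Q : operad) : Prop :=
  exists f : forall n, {linear P n -> Q n},
    [/\ forall n, bijective (f n),
        f 0%N (op_id P) = op_id Q,
        forall m n p (e : (m + n)%N = p) i a b,
          f p (op_comp e i a b) = op_comp e i (f m a) (f n b)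
      & forall n a s, f n (op_act a s) = op_act (f n a) s].

Section Quotient.
Variables (P : nsoperad).

Record is_ideal (J : forall n, P n -> Prop) : Prop := IsIdeal {
  ideal_sub : forall n, submodule (J n);
  ideal_compl : forall m n p (e : (m + n)%N = p) i (a : P m) (b : P n),
    J m a -> J p (op_comp e i a b);
  ideal_compr : forall m n p (e : (m + n)%N = p) i (a : P m) (b : P n),
    J n b -> J p (op_comp e i a b)
}.

Definition gen_ideal (R : forall n, P n -> Prop) n (x : P n) : Prop :=
  forall J, is_ideal J -> (forall m y, R m y -> J m y) -> J n x.

Lemma gen_ideal_ideal (R : forall n, P n -> Prop) : is_ideal (gen_ideal R).
Proof.
split.
- move=> n; split=> [|c x y Jx Jy] J idJ RJ; have [J0 JP] := ideal_sub idJ n.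
    exact: J0.
  by apply: JP; [apply: Jx | apply: Jy].
- by move=> m n p e i a b Ja J idJ RJ; apply: ideal_compl => //; apply: Ja.
- by move=> m n p e i a b Jb J idJ RJ; apply: ideal_compr => //; apply: Jb.
Qed.

Variables (J : forall n, P n -> Prop) (idJ : is_ideal J).

Local Notation Q n := (quot (ideal_sub idJ n)).
Local Notation pi := (qpi (ideal_sub idJ _)).
Let pi_lin n : linear (pi : P n -> Q n). Proof. exact: qpi_is_linear. Qed.
Let pi_eq n (x y : P n) : pi x = pi y :> Q n <-> J (x - y).
Proof. exact: qpi_eq. Qed.
Let pi_ind n (R : Q n -> Prop) : (forall x, R (pi x)) -> forall q, R q.
Proof. exact: qpi_ind. Qed.

Definition qop_comp m n p (e : (m + n)%N = p) i (a : Q m) (b : Q n) : Q p :=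
  pi (op_comp e i (qrepr a) (qrepr b)).

Lemma qop_compE m n p (e : (m + n)%N = p) i (a : P m) (b : P n) :
  qop_comp e i (pi a) (pi b) = pi (op_comp e i a b).
Proof.
apply/pi_eq; set a' := qrepr _; set b' := qrepr _.
have Ja : J (a' - a) by apply: qrepr_pi.
have Jb : J (b' - b) by apply: qrepr_pi.
have bl := op_comp_bilinear P e i.
have -> : op_comp e i a' b' - op_comp e i a b =
    1 *: op_comp e i (a' - a) b' + op_comp e i a (b' - b).
  rewrite scale1r bilinear_mapDl // bilinear_mapDr //.
  by rewrite [op_comp e i (- a) b']bilinear_mapNl // [op_comp e i a (- b)]bilinear_mapNr // addrA subrK.
apply: (ideal_sub idJ p).2; first exact: ideal_compl.
exact: ideal_compr.
Qed.

Fact qop_comp_bilinear m n p (e : (m + n)%N = p) i :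
  bilinear_map (qop_comp e i).
Proof.
have bl := op_comp_bilinear P e i.
split=> [b c a a' | a c b b'].
  elim/pi_ind: b => b; elim/pi_ind: a => a; elim/pi_ind: a' => a' /=.
  by rewrite -pi_lin !qop_compE bl.1 pi_lin.
elim/pi_ind: b => b; elim/pi_ind: a => a; elim/pi_ind: b' => b' /=.
by rewrite -pi_lin !qop_compE bl.2 pi_lin.
Qed.

Definition quotient_nsoperad : nsoperad.
Proof.
apply: (@NsOperad (fun n => Q n : lmodType k) (pi (op_id P)) qop_comp qop_comp_bilinear).
- move=> m n p q r s e1 e2 e3 e4 i j l a b c le.
  elim/pi_ind: a => a; elim/pi_ind: b => b; elim/pi_ind: c => c.
  by rewrite !qop_compE (op_compA e1 e2 e3 e4 _ _ _ le).
- move=> m n p q r s e1 e2 e3 e4 i i' l l' a b c lt le le'.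
  elim/pi_ind: a => a; elim/pi_ind: b => b; elim/pi_ind: c => c.
  by rewrite !qop_compE (op_compC e1 e2 e3 e4 _ _ _ lt le le').
- by move=> n e i; elim/pi_ind => a; rewrite qop_compE op_id_comp.
- by move=> n e i; elim/pi_ind => a; rewrite qop_compE op_comp_id.
Defined.

End Quotient.

Section Single.
Variables (T : finType) (W : lmodType k).

Definition single (t : T) (w : W) : {ffun T -> W} :=
  [ffun u => if u == t then w else 0].

Lemma single_linear t : linear (single t).
Proof.
move=> c w w'; apply/ffunP => u; rewrite !ffunE.
by case: ifP; rewrite // scaler0 addr0.
Qed.

Lemma single_sum (x : {ffun T -> W}) : x = \sum_t single t (x t).
Proof.
apply/ffunP => u; rewrite sum_ffunE (bigD1 u) //= big1 => [|t ne].
  by rewrite ffunE eqxx addr0.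
by rewrite ffunE eq_sym (negbTE ne).
Qed.

Lemma single_ind (R : {ffun T -> W} -> Prop) :
  R 0 -> (forall x y, R x -> R y -> R (x + y)) ->
  (forall t w, R (single t w)) -> forall x, R x.
Proof.
move=> R0 RD R1 x; rewrite (single_sum x).
by elim/big_ind: _ => // t _; apply: R1.
Qed.

End Single.

Section Bext.
Variables (S T U : finType) (A B C : lmodType k).
Variables (f : S -> T -> U) (b : S -> T -> A -> B -> C).
Hypothesis bb : forall s t, bilinear_map (b s t).

Definition bext (x : {ffun S -> A}) (y : {ffun T -> B}) : {ffun U -> C} :=
  \sum_s \sum_t single (f s t) (b s t (x s) (y t)).

Lemma bext_bilinear : bilinear_map bext.
Proof.
split=> [y c x x' | x c y y'] /=; rewrite /bext scaler_sumr -big_split /=.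
  apply: eq_bigr => s _; rewrite scaler_sumr -big_split; apply: eq_bigr => t _.
  by rewrite !ffunE (bb s t).1 single_linear.
apply: eq_bigr => s _; rewrite scaler_sumr -big_split; apply: eq_bigr => t _.
by rewrite !ffunE (bb s t).2 single_linear.
Qed.

Lemma bext_single s t a c :
  bext (single s a) (single t c) = single (f s t) (b s t a c).
Proof.
have s0 u : single u (0 : C) = 0 by apply/ffunP => v; rewrite !ffunE if_same.
rewrite /bext (bigD1 s) //= [X in _ + X]big1 ?addr0 => [|s' ne].
  rewrite (bigD1 t) //= [X in _ + X]big1 ?addr0 => [|t' ne].
    by rewrite !ffunE !eqxx.
  by rewrite !ffunE (negbTE ne) (bilinear_map0r (bb _ _)) s0.
by rewrite big1 // => t' _; rewrite ffunE (negbTE ne) (bilinear_map0l (bb _ _)) s0.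
Qed.

End Bext.
(* The regular operad of a non-symmetric operad: [single s a] stands for
   a (x) s, the operation feeding input s i to slot i of a. *)
Section Regular.
Variable P : nsoperad.

Local Notation S n := {ffun 'S_n.+1 -> P n}.

Definition reg_id : S 0 := single 1%g (op_id P).

Definition reg_comp m n p (e : (m + n)%N = p) (i : 'I_m.+1) : S m -> S n -> S p :=
  bext (fun (s : 'S_m.+1) (t : 'S_n.+1) => perm_comp e ((s^-1)%g i) s t)
       (fun (s : 'S_m.+1) (_ : 'S_n.+1) => op_comp e ((s^-1)%g i)).

Definition reg_act n (x : S n) (s : 'S_n.+1) : S n :=
  [ffun t => x (t * s^-1)%g].

Fact reg_comp_bilinear m n p (e : (m + n)%N = p) i :
  bilinear_map (reg_comp e i).
Proof. by apply: bext_bilinear => s t; apply: op_comp_bilinear. Qed.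

Lemma reg_comp_single m n p (e : (m + n)%N = p) i s t (a : P m) (b : P n) :
  reg_comp e i (single s a) (single t b) =
  single (perm_comp e ((s^-1)%g i) s t) (op_comp e ((s^-1)%g i) a b).
Proof. by rewrite /reg_comp bext_single // => *; apply: op_comp_bilinear. Qed.

Fact reg_act_linear n (s : 'S_n.+1) : linear (fun x : S n => reg_act x s).
Proof. by move=> c x y; apply/ffunP => t; rewrite !ffunE. Qed.

Lemma reg_act_single n (s t : 'S_n.+1) (a : P n) :
  reg_act (single t a) s = single (t * s)%g a.
Proof. by apply/ffunP => u; rewrite !ffunE (can2_eq (mulgKV s) (mulgK s)). Qed.

Fact reg_compA m n p q r u (e1 : (m + n)%N = p) (e2 : (p + q)%N = r)
    (e3 : (n + q)%N = u) (e4 : (m + u)%N = r)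
    (i : 'I_m.+1) (j : 'I_n.+1) (l : 'I_p.+1) (x : S m) (y : S n) (z : S q) :
  l = (i + j)%N :> nat ->
  reg_comp e2 l (reg_comp e1 i x y) z = reg_comp e4 i x (reg_comp e3 j y z).
Proof.
move=> le; have {le}-> : l = slot p i i j.
  by apply/val_inj; rewrite /= slotE // eqxx.
have B0l := bilinear_map0l (reg_comp_bilinear _ _).
have B0r := bilinear_map0r (reg_comp_bilinear _ _).
have BDl := bilinear_mapDl (reg_comp_bilinear _ _).
have BDr := bilinear_mapDr (reg_comp_bilinear _ _).
elim/single_ind: x => [|x x' IHx IHx'|s a]; first by rewrite !B0l.
  by rewrite !BDl IHx IHx'.
elim/single_ind: y => [|y y' IHx IHx'|t b]; first by rewrite !(B0l, B0r).
  by rewrite !(BDl, BDr) IHx IHx'.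
elim/single_ind: z => [|z z' IHx IHx'|v c]; first by rewrite !B0r.
  by rewrite !BDr IHx IHx'.
rewrite !reg_comp_single.
set i' := (s^-1)%g i; set j' := (t^-1)%g j.
have ii : s i' = i by rewrite permKV.
have jj : t j' = j by rewrite permKV.
have -> : ((perm_comp e1 i' s t)^-1)%g (slot p i i j) = slot p i' i' j'.
  by apply: (canLR (permK _)); rewrite perm_compE ii jj.
congr single; last exact: op_compA_slot.
apply/permP; apply: (slot_ext e4 (i := i')) => o; apply: (slot_ext e3 (i := j')).
move=> g w; rewrite !perm_compE -(slot_seq e1 e2 e3 e4) !perm_compE.
by rewrite -(slot_seq e1 e2 e3 e4).
Qed.

Fact reg_compC m n p q r u (e1 : (m + n)%N = p) (e2 : (p + q)%N = r)
    (e3 : (m + q)%N = u) (e4 : (u + n)%N = r)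
    (i i' : 'I_m.+1) (l : 'I_p.+1) (l' : 'I_u.+1) (x : S m) (y : S n) (z : S q) :
  (i < i')%N -> l = (i' + n)%N :> nat -> l' = i :> nat ->
  reg_comp e2 l (reg_comp e1 i x y) z = reg_comp e4 l' (reg_comp e3 i' x z) y.
Proof.
move=> lt le le'.
have {le}-> : l = slot p i i' (ord0 : 'I_n.+1).
  by apply/val_inj; rewrite /= slotE // -val_eqE /=; slot_cases; lia.
have {le'}-> : l' = slot u i' i (ord0 : 'I_q.+1).
  by apply/val_inj; rewrite /= slotE // -val_eqE /=; slot_cases; lia.
have ne : i != i' by rewrite -val_eqE /= neq_ltn lt.
have B0l := bilinear_map0l (reg_comp_bilinear _ _).
have B0r := bilinear_map0r (reg_comp_bilinear _ _).
have BDl := bilinear_mapDl (reg_comp_bilinear _ _).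
have BDr := bilinear_mapDr (reg_comp_bilinear _ _).
elim/single_ind: x => [|x x' IHx IHx'|s a]; first by rewrite !B0l.
  by rewrite !BDl IHx IHx'.
elim/single_ind: y => [|y y' IHx IHx'|t b]; first by rewrite !(B0l, B0r).
  by rewrite !(BDl, BDr) IHx IHx'.
elim/single_ind: z => [|z z' IHx IHx'|v c]; first by rewrite !(B0l, B0r).
  by rewrite !(BDl, BDr) IHx IHx'.
rewrite !reg_comp_single.
set o := (s^-1)%g i; set o' := (s^-1)%g i'.
have oo : s o = i by rewrite permKV.
have oo' : s o' = i' by rewrite permKV.
have neo : o != o' by rewrite (inj_eq perm_inj).
have -> : ((perm_comp e1 o s t)^-1)%g (slot p i i' (ord0 : 'I_n.+1))
    = slot p o o' (ord0 : 'I_n.+1).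
  by apply: (canLR (permK _)); rewrite perm_compE oo oo'; apply: slot_neq;
     rewrite eq_sym.
have -> : ((perm_comp e3 o' s v)^-1)%g (slot u i' i (ord0 : 'I_q.+1))
    = slot u o' o (ord0 : 'I_q.+1).
  by apply: (canLR (permK _)); rewrite perm_compE oo oo'; apply: slot_neq.
congr single; last exact: op_compC_slot.
apply/permP; apply: (slot_ext e2 (i := slot p o o' (ord0 : 'I_n.+1))) => h w'.
move: h; apply: (slot_ext e1 (i := o)) => h w.
rewrite !perm_compE.
rewrite [in RHS](slot_par e1 e2 e3 e4 _ _ _ _ ord0) // !perm_compE.
by rewrite oo oo' (slot_par e1 e2 e3 e4 _ _ _ _ (v ord0)).
Qed.

Fact reg_id_comp n (e : (0 + n)%N = n) i (x : S n) : reg_comp e i reg_id x = x.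
Proof.
have bl := reg_comp_bilinear e i.
elim/single_ind: x => [|x x' IHx IHx'|s a]; first exact: bilinear_map0r.
  by rewrite bilinear_mapDr // IHx IHx'.
rewrite reg_comp_single op_id_comp; congr single.
apply/permP; rewrite invg1 perm1.
apply: (slot_ext e (i := i)) => l j; rewrite perm_compE !perm1.
rewrite !(ord1 i) !(ord1 l); apply/val_inj.
by rewrite /= !slotE // eqxx add0n; congr (nat_of_ord (s _)); apply/val_inj;
   rewrite /= slotE.
Qed.

Fact reg_comp_id n (e : (n + 0)%N = n) i (x : S n) : reg_comp e i x reg_id = x.
Proof.
have bl := reg_comp_bilinear e i.
elim/single_ind: x => [|x x' IHx IHx'|s a]; first exact: bilinear_map0l.
  by rewrite bilinear_mapDl // IHx IHx'.
rewrite reg_comp_single op_comp_id; congr single.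
apply/permP; set o := (s^-1)%g i.
have E (c l : 'I_n.+1) (j : 'I_1) : slot n c l j = l.
  apply/val_inj; rewrite /= slotE // (ord1 j) /= !addn0.
  by case: eqP => [->|_] //; rewrite if_same.
by apply: (slot_ext e (i := o)) => l j; rewrite perm_compE !E.
Qed.

Definition reg_nsoperad : nsoperad :=
  @NsOperad (fun n => S n : lmodType k) reg_id reg_comp reg_comp_bilinear reg_compA reg_compC
    reg_id_comp reg_comp_id.

Fact reg_act1 n (x : S n) : reg_act x 1%g = x.
Proof. by apply/ffunP => t; rewrite ffunE invg1 mulg1. Qed.

Fact reg_actM n (x : S n) (s t : 'S_n.+1) :
  reg_act x (s * t)%g = reg_act (reg_act x s) t.
Proof. by apply/ffunP => u; rewrite !ffunE invMg mulgA. Qed.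

Fact reg_act_comp m n p (e : (m + n)%N = p) (i : 'I_m.+1) (x : S m) (y : S n)
    (s : 'S_m.+1) (t : 'S_n.+1) :
  reg_comp e (s i) (reg_act x s) (reg_act y t) =
  reg_act (reg_comp e i x y) (perm_comp e i s t).
Proof.
have A0 q (w : 'S_q.+1) : reg_act (0 : S q) w = 0.
  by apply/ffunP => u; rewrite !ffunE.
have AD q (w : 'S_q.+1) (z z' : S q) :
    reg_act (z + z') w = reg_act z w + reg_act z' w.
  by apply/ffunP => u; rewrite !ffunE.
have B0l := bilinear_map0l (reg_comp_bilinear e _).
have B0r := bilinear_map0r (reg_comp_bilinear e _).
have BDl := bilinear_mapDl (reg_comp_bilinear e _).
have BDr := bilinear_mapDr (reg_comp_bilinear e _).
elim/single_ind: x => [|x x' IHx IHx'|u a]; first by rewrite !(A0, B0l).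
  by rewrite !(AD, BDl) IHx IHx'.
elim/single_ind: y => [|y y' IHx IHx'|v b]; first by rewrite !(A0, B0r).
  by rewrite !(AD, BDr) IHx IHx'.
rewrite !reg_act_single !reg_comp_single reg_act_single.
rewrite invMg permM permK; congr single.
apply/permP; apply: (slot_ext e (i := (u^-1)%g i)) => l j.
by rewrite permM !perm_compE !permM !permKV perm_compE.
Qed.

Definition regular_operad : operad :=
  @Operad reg_nsoperad reg_act reg_act_linear reg_act1 reg_actM reg_act_comp.

End Regular.

Section Hadamard.
Variables P Q : operad.

Local Notation H n := (tensor (P n) (Q n)).

Definition hadamard_id : H 0 := tpure (op_id P) (op_id Q).

Definition hadamard_comp m n p (e : (m + n)%N = p) (i : 'I_m.+1)
    (x : H m) (y : H n) : H p :=
  tlift (fun a a' => tlift (fun b b' =>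
    tpure (op_comp e i a b) (op_comp e i a' b')) y) x.

Definition hadamard_act n (x : H n) (s : 'S_n.+1) : H n :=
  tlift (fun a a' => tpure (op_act a s) (op_act a' s)) x.

Let inner_bilinear m n p (e : (m + n)%N = p) i (a : P m) (a' : Q m) :
  bilinear_map (fun (b : P n) (b' : Q n) =>
    tpure (op_comp e i a b) (op_comp e i a' b')).
Proof.
split=> [b' | b] c y y'.
  by rewrite /= (op_comp_bilinear P e i).2 (tpure_bilinear _ _).1.
by rewrite /= (op_comp_bilinear Q e i).2 (tpure_bilinear _ _).2.
Qed.

Let outer_bilinear m n p (e : (m + n)%N = p) i (y : H n) :
  bilinear_map (fun (a : P m) (a' : Q m) => tlift (fun b b' =>
    tpure (op_comp e i a b) (op_comp e i a' b')) y).
Proof.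
split=> [a' | a] c x x' /=; rewrite /tlift /fsum_eval scaler_sumr -big_split.
  apply: eq_bigr => b _.
  by rewrite (op_comp_bilinear P e i).1 (tpure_bilinear _ _).1.
apply: eq_bigr => b _.
by rewrite (op_comp_bilinear Q e i).1 (tpure_bilinear _ _).2.
Qed.

Let act_bilinear n (s : 'S_n.+1) : bilinear_map (fun (a : P n) (a' : Q n) =>
  tpure (op_act a s) (op_act a' s)).
Proof.
split=> [b' | b] c y y'; rewrite /=.
  by rewrite (op_act_linear s) (tpure_bilinear _ _).1.
by rewrite (op_act_linear s) (tpure_bilinear _ _).2.
Qed.

Lemma hadamard_comp_pure m n p (e : (m + n)%N = p) i
    (a : P m) (a' : Q m) (b : P n) (b' : Q n) :
  hadamard_comp e i (tpure a a') (tpure b b') =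
  tpure (op_comp e i a b) (op_comp e i a' b').
Proof.
rewrite /hadamard_comp tlift_pure; last exact: outer_bilinear.
by rewrite tlift_pure //; apply: inner_bilinear.
Qed.

Lemma hadamard_act_pure n (s : 'S_n.+1) (a : P n) (a' : Q n) :
  hadamard_act (tpure a a') s = tpure (op_act a s) (op_act a' s).
Proof. by rewrite /hadamard_act tlift_pure //; apply: act_bilinear. Qed.

Fact hadamard_comp_bilinear m n p (e : (m + n)%N = p) i :
  bilinear_map (hadamard_comp e i).
Proof.
split=> [y | x]; first by apply: tlift_linear; apply: outer_bilinear.
move=> c y y'; rewrite /hadamard_comp /tlift [in LHS]/fsum_eval.
rewrite /fsum_eval scaler_sumr -big_split; apply: eq_bigr => a _.
exact: (tlift_linear (inner_bilinear _ _ _ _)).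
Qed.

Fact hadamard_act_linear n (s : 'S_n.+1) :
  linear (fun x : H n => hadamard_act x s).
Proof. by apply: tlift_linear; apply: act_bilinear. Qed.

Let B0l m n p e i := bilinear_map0l (@hadamard_comp_bilinear m n p e i).
Let B0r m n p e i := bilinear_map0r (@hadamard_comp_bilinear m n p e i).
Let BDl m n p e i := bilinear_mapDl (@hadamard_comp_bilinear m n p e i).
Let BDr m n p e i := bilinear_mapDr (@hadamard_comp_bilinear m n p e i).
Let AD n (s : 'S_n.+1) x y :
  hadamard_act (x + y) s = hadamard_act x s + hadamard_act y s.
Proof. by have := hadamard_act_linear s 1 x y; rewrite !scale1r. Qed.
Let A0 n (s : 'S_n.+1) : hadamard_act 0 s = 0.
Proof. by apply: (addrI (hadamard_act 0 s)); rewrite -AD !addr0. Qed.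

Fact hadamard_compA m n p q r u (e1 : (m + n)%N = p) (e2 : (p + q)%N = r)
    (e3 : (n + q)%N = u) (e4 : (m + u)%N = r)
    (i : 'I_m.+1) (j : 'I_n.+1) (l : 'I_p.+1) (x : H m) (y : H n) (z : H q) :
  l = (i + j)%N :> nat ->
  hadamard_comp e2 l (hadamard_comp e1 i x y) z =
  hadamard_comp e4 i x (hadamard_comp e3 j y z).
Proof.
move=> le.
elim/tensor_ind: x => [|x x' IHx IHx'|a a']; first by rewrite !B0l.
  by rewrite !BDl IHx IHx'.
elim/tensor_ind: y => [|y y' IHx IHx'|b b']; first by rewrite !(B0l, B0r).
  by rewrite !(BDl, BDr) IHx IHx'.
elim/tensor_ind: z => [|z z' IHx IHx'|c c']; first by rewrite !B0r.
  by rewrite !BDr IHx IHx'.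
by rewrite !hadamard_comp_pure !(op_compA e1 e2 e3 e4 _ _ _ le).
Qed.

Fact hadamard_compC m n p q r u (e1 : (m + n)%N = p) (e2 : (p + q)%N = r)
    (e3 : (m + q)%N = u) (e4 : (u + n)%N = r)
    (i i' : 'I_m.+1) (l : 'I_p.+1) (l' : 'I_u.+1) (x : H m) (y : H n) (z : H q) :
  (i < i')%N -> l = (i' + n)%N :> nat -> l' = i :> nat ->
  hadamard_comp e2 l (hadamard_comp e1 i x y) z =
  hadamard_comp e4 l' (hadamard_comp e3 i' x z) y.
Proof.
move=> lt le le'.
elim/tensor_ind: x => [|x x' IHx IHx'|a a']; first by rewrite !B0l.
  by rewrite !BDl IHx IHx'.
elim/tensor_ind: y => [|y y' IHx IHx'|b b']; first by rewrite !(B0l, B0r).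
  by rewrite !(BDl, BDr) IHx IHx'.
elim/tensor_ind: z => [|z z' IHx IHx'|c c']; first by rewrite !(B0l, B0r).
  by rewrite !(BDl, BDr) IHx IHx'.
by rewrite !hadamard_comp_pure !(op_compC e1 e2 e3 e4 _ _ _ lt le le').
Qed.

Fact hadamard_id_comp n (e : (0 + n)%N = n) i x :
  hadamard_comp e i hadamard_id x = x.
Proof.
elim/tensor_ind: x => [|x x' IHx IHx'|a a']; first by rewrite B0r.
  by rewrite BDr IHx IHx'.
by rewrite hadamard_comp_pure !op_id_comp.
Qed.

Fact hadamard_comp_id n (e : (n + 0)%N = n) i x :
  hadamard_comp e i x hadamard_id = x.
Proof.
elim/tensor_ind: x => [|x x' IHx IHx'|a a']; first by rewrite B0l.
  by rewrite BDl IHx IHx'.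
by rewrite hadamard_comp_pure !op_comp_id.
Qed.

Definition hadamard_nsoperad : nsoperad :=
  @NsOperad (fun n => H n : lmodType k) hadamard_id hadamard_comp hadamard_comp_bilinear hadamard_compA
    hadamard_compC hadamard_id_comp hadamard_comp_id.

Fact hadamard_act1 n (x : H n) : hadamard_act x 1%g = x.
Proof.
elim/tensor_ind: x => [|x x' IHx IHx'|a a']; first by rewrite A0.
  by rewrite AD IHx IHx'.
by rewrite hadamard_act_pure !op_act1.
Qed.

Fact hadamard_actM n (x : H n) (s t : 'S_n.+1) :
  hadamard_act x (s * t)%g = hadamard_act (hadamard_act x s) t.
Proof.
elim/tensor_ind: x => [|x x' IHx IHx'|a a']; first by rewrite !A0.
  by rewrite !AD IHx IHx'.
by rewrite !hadamard_act_pure !op_actM.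
Qed.

Fact hadamard_act_comp m n p (e : (m + n)%N = p) (i : 'I_m.+1)
    (x : H m) (y : H n) (s : 'S_m.+1) (t : 'S_n.+1) :
  hadamard_comp e (s i) (hadamard_act x s) (hadamard_act y t) =
  hadamard_act (hadamard_comp e i x y) (perm_comp e i s t).
Proof.
elim/tensor_ind: x => [|x x' IHx IHx'|a a']; first by rewrite !(A0, B0l).
  by rewrite !(AD, BDl) IHx IHx'.
elim/tensor_ind: y => [|y y' IHx IHx'|b b']; first by rewrite !(A0, B0r).
  by rewrite !(AD, BDr) IHx IHx'.
by rewrite !(hadamard_act_pure, hadamard_comp_pure) !op_act_comp.
Qed.

Definition hadamard : operad :=
  @Operad hadamard_nsoperad hadamard_act hadamard_act_linear hadamard_act1
    hadamard_actM hadamard_act_comp.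

End Hadamard.
(* The operad Perm: [single i 1] is the basis element e_i of arity n+1 (with
   i counted from 0); partial composition is the composition of the basis
   elements in which all but one of the inner ones are the identity. *)
Section PermOperad.

Local Notation E n := {ffun 'I_n.+1 -> k^o}.

Definition perm_op_id : E 0 := single ord0 (1 : k^o).

Definition perm_op_comp m n p (e : (m + n)%N = p) (i : 'I_m.+1) :
    E m -> E n -> E p :=
  bext (slot p i) (fun _ _ (a b : k^o) => a * b : k^o).

Definition perm_op_act n (x : E n) (s : 'S_n.+1) : E n :=
  [ffun i => x ((s^-1)%g i)].

Let mul_bilinear : bilinear_map (fun a b : k^o => a * b : k^o).
Proof.
split=> [b c a a' | a c b b'] /=; first by rewrite mulrDl scalerAl.
by rewrite mulrDr scalerAr.
Qed.

Fact perm_op_comp_bilinear m n p (e : (m + n)%N = p) i :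
  bilinear_map (perm_op_comp e i).
Proof. exact: bext_bilinear. Qed.

Lemma perm_op_comp_single m n p (e : (m + n)%N = p) i l j (a b : k^o) :
  perm_op_comp e i (single l a) (single (j : 'I_n.+1) b) =
  single (slot p i l j) (a * b : k^o).
Proof. by rewrite /perm_op_comp bext_single. Qed.

Fact perm_op_act_linear n (s : 'S_n.+1) : linear (fun x : E n => perm_op_act x s).
Proof. by move=> c x y; apply/ffunP => t; rewrite !ffunE. Qed.

Lemma perm_op_act_single n (s : 'S_n.+1) i (a : k^o) :
  perm_op_act (single i a) s = single (s i) a.
Proof.
apply/ffunP => u; rewrite !ffunE.
by rewrite (can2_eq (permKV s) (permK s)).
Qed.

Let B0l m n p e i := bilinear_map0l (@perm_op_comp_bilinear m n p e i).
Let B0r m n p e i := bilinear_map0r (@perm_op_comp_bilinear m n p e i).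
Let BDl m n p e i := bilinear_mapDl (@perm_op_comp_bilinear m n p e i).
Let BDr m n p e i := bilinear_mapDr (@perm_op_comp_bilinear m n p e i).

Fact perm_op_compA m n p q r u (e1 : (m + n)%N = p) (e2 : (p + q)%N = r)
    (e3 : (n + q)%N = u) (e4 : (m + u)%N = r)
    (i : 'I_m.+1) (j : 'I_n.+1) (l : 'I_p.+1) (x : E m) (y : E n) (z : E q) :
  l = (i + j)%N :> nat ->
  perm_op_comp e2 l (perm_op_comp e1 i x y) z =
  perm_op_comp e4 i x (perm_op_comp e3 j y z).
Proof.
move=> le; have {le}-> : l = slot p i i j.
  by apply/val_inj; rewrite /= slotE // eqxx.
elim/single_ind: x => [|x x' IHx IHx'|s a]; first by rewrite !B0l.
  by rewrite !BDl IHx IHx'.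
elim/single_ind: y => [|y y' IHx IHx'|t b]; first by rewrite !(B0l, B0r).
  by rewrite !(BDl, BDr) IHx IHx'.
elim/single_ind: z => [|z z' IHx IHx'|v c]; first by rewrite !B0r.
  by rewrite !BDr IHx IHx'.
by rewrite !perm_op_comp_single mulrA (slot_seq e1 e2 e3 e4).
Qed.

Fact perm_op_compC m n p q r u (e1 : (m + n)%N = p) (e2 : (p + q)%N = r)
    (e3 : (m + q)%N = u) (e4 : (u + n)%N = r)
    (i i' : 'I_m.+1) (l : 'I_p.+1) (l' : 'I_u.+1) (x : E m) (y : E n) (z : E q) :
  (i < i')%N -> l = (i' + n)%N :> nat -> l' = i :> nat ->
  perm_op_comp e2 l (perm_op_comp e1 i x y) z =
  perm_op_comp e4 l' (perm_op_comp e3 i' x z) y.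
Proof.
move=> lt le le'.
have {le}-> : l = slot p i i' (ord0 : 'I_n.+1).
  by apply/val_inj; rewrite /= slotE // -val_eqE /=; slot_cases; lia.
have {le'}-> : l' = slot u i' i (ord0 : 'I_q.+1).
  by apply/val_inj; rewrite /= slotE // -val_eqE /=; slot_cases; lia.
have ne : i != i' by rewrite -val_eqE /= neq_ltn lt.
elim/single_ind: x => [|x x' IHx IHx'|s a]; first by rewrite !B0l.
  by rewrite !BDl IHx IHx'.
elim/single_ind: y => [|y y' IHx IHx'|t b]; first by rewrite !(B0l, B0r).
  by rewrite !(BDl, BDr) IHx IHx'.
elim/single_ind: z => [|z z' IHx IHx'|v c]; first by rewrite !(B0l, B0r).
  by rewrite !(BDl, BDr) IHx IHx'.
rewrite !perm_op_comp_single (slot_par e1 e2 e3 e4 _ _ _ _ ord0) //.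
by rewrite mulrAC.
Qed.

Fact perm_op_id_comp n (e : (0 + n)%N = n) i (x : E n) :
  perm_op_comp e i perm_op_id x = x.
Proof.
elim/single_ind: x => [|x x' IHx IHx'|s a]; first by rewrite B0r.
  by rewrite BDr IHx IHx'.
rewrite perm_op_comp_single mul1r; congr single.
by apply/val_inj; rewrite /= slotE // (ord1 i).
Qed.

Fact perm_op_comp_id n (e : (n + 0)%N = n) i (x : E n) :
  perm_op_comp e i x perm_op_id = x.
Proof.
elim/single_ind: x => [|x x' IHx IHx'|s a]; first by rewrite B0l.
  by rewrite BDl IHx IHx'.
rewrite perm_op_comp_single mulr1; congr single.
apply/val_inj; rewrite /= slotE // !addn0.
by case: eqP => [->|_] //; rewrite if_same.
Qed.

Fact perm_op_act1 n (x : E n) : perm_op_act x 1%g = x.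
Proof. by apply/ffunP => t; rewrite ffunE invg1 perm1. Qed.

Fact perm_op_actM n (x : E n) (s t : 'S_n.+1) :
  perm_op_act x (s * t)%g = perm_op_act (perm_op_act x s) t.
Proof. by apply/ffunP => u; rewrite !ffunE invMg permM. Qed.

Fact perm_op_act_comp m n p (e : (m + n)%N = p) (i : 'I_m.+1)
    (x : E m) (y : E n) (s : 'S_m.+1) (t : 'S_n.+1) :
  perm_op_comp e (s i) (perm_op_act x s) (perm_op_act y t) =
  perm_op_act (perm_op_comp e i x y) (perm_comp e i s t).
Proof.
have A0 q (w : 'S_q.+1) : perm_op_act (0 : E q) w = 0.
  by apply/ffunP => u; rewrite !ffunE.
have AD q (w : 'S_q.+1) (z z' : E q) :
    perm_op_act (z + z') w = perm_op_act z w + perm_op_act z' w.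
  by apply/ffunP => u; rewrite !ffunE.
elim/single_ind: x => [|x x' IHx IHx'|u a]; first by rewrite !(A0, B0l).
  by rewrite !(AD, BDl) IHx IHx'.
elim/single_ind: y => [|y y' IHx IHx'|v b]; first by rewrite !(A0, B0r).
  by rewrite !(AD, BDr) IHx IHx'.
rewrite !perm_op_act_single !perm_op_comp_single perm_op_act_single.
by rewrite perm_compE.
Qed.

Definition Perm_operad : operad :=
  @Operad (@NsOperad (fun n => E n : lmodType k) perm_op_id perm_op_comp perm_op_comp_bilinear
      perm_op_compA perm_op_compC perm_op_id_comp perm_op_comp_id)
    perm_op_act perm_op_act_linear perm_op_act1 perm_op_actM perm_op_act_comp.

(* The relations (xy)z = x(yz) = x(zy). *)
Lemma Perm_relations (mu : Perm_operad 1%N := single ord0 (1 : k^o)) :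
  let xyz := op_comp (erefl : (1 + 1)%N = 2) (ord_max : 'I_2) mu mu in
  op_comp (erefl : (1 + 1)%N = 2) (ord0 : 'I_2) mu mu = xyz /\
  xyz = op_act xyz (tperm (inord 1) (inord 2)).
Proof.
have E i : op_comp (erefl : (1 + 1)%N = 2) i mu mu = single ord0 (1 : k^o).
  rewrite [LHS]perm_op_comp_single mulr1; congr single; apply/val_inj.
  by rewrite /= slotE //; case: i => [[|[|]]].
split; rewrite !E // [RHS]perm_op_act_single; congr single.
by rewrite tpermD // -val_eqE /= inordK.
Qed.

End PermOperad.

End Operads.

Section Trees.
Variable I : finType.

Inductive tree := Leaf | Node of I & tree & tree.

Fixpoint tree_encode (t : tree) : GenTree.tree I :=
  if t is Node a l r
  then GenTree.Node 1 [:: GenTree.Leaf a; tree_encode l; tree_encode r]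
  else GenTree.Node 0 [::].

Fixpoint tree_decode (t : GenTree.tree I) : option tree :=
  match t with
  | GenTree.Node 0 [::] => Some Leaf
  | GenTree.Node 1 [:: GenTree.Leaf a; l; r] =>
      if (tree_decode l, tree_decode r) is (Some l', Some r')
      then Some (Node a l' r') else None
  | _ => None
  end.

Lemma tree_encodeK : pcancel tree_encode tree_decode.
Proof. by elim=> //= a l -> r ->. Qed.

HB.instance Definition _ := Countable.copy tree (pcan_type tree_encodeK).

Fixpoint nodes (t : tree) : nat :=
  if t is Node _ l r then (nodes l + nodes r).+1 else 0.

(* [graft s i t] substitutes t for the leaf number i of s, leaves being
   numbered from left to right starting from 0 *)
Fixpoint graft (s : tree) (i : nat) (t : tree) : tree :=
  if s is Node a l r then
    if (i <= nodes l)%N then Node a (graft l i t) r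
    else Node a l (graft r (i - (nodes l).+1) t)
  else t.

Lemma nodes_graft s i t : nodes (graft s i t) = (nodes s + nodes t)%N.
Proof. by elim: s i => //= a l IHl r IHr i; case: ifP => _ /=; rewrite ?(IHl, IHr); lia. Qed.

Lemma graft_seq s i t j u : (i <= nodes s)%N -> (j <= nodes t)%N ->
  graft (graft s i t) (i + j) u = graft s i (graft t j u).
Proof.
elim: s i => [|a l IHl r IHr] i /=.
  by rewrite leqn0 => /eqP ->.
case: (leqP i (nodes l)) => hi his hj /=; rewrite ?nodes_graft.
  by rewrite ifT ?IHl //; lia.
by rewrite ifF; [rewrite -IHr // ; [congr (Node _ _ (graft _ _ _)); lia|lia] | lia].
Qed.

Lemma graft_par s i i' t u : (i < i')%N -> (i' <= nodes s)%N ->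
  graft (graft s i t) (i' + nodes t) u = graft (graft s i' u) i t.
Proof.
elim: s i i' => [|a l IHl r IHr] i i' /=; first lia.
move=> lt hs.
case: (leqP i' (nodes l)) => hi' /=.
  rewrite !ifT /= ?nodes_graft ?ifT ?IHl //; lia.
case: (leqP i (nodes l)) => hi /=; rewrite ?nodes_graft.
  rewrite ifF ?ifT //; last lia.
  congr (Node _ _ (graft _ _ _)); lia.
rewrite ifF ?ifF /=; try lia.
rewrite -IHr; [congr (Node _ _ (graft _ _ _)); lia | lia | lia].
Qed.

Lemma graft_leaf s i : graft s i Leaf = s.
Proof. by elim: s i => //= a l IHl r IHr i; rewrite IHl IHr if_same. Qed.

Section FixedSize.
Variable n : nat.

Record ntree := NTree { ntree_val :> tree; _ : nodes ntree_val == n }.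
HB.instance Definition _ := [isSub for ntree_val].
HB.instance Definition _ := [Countable of ntree by <:].

Fixpoint trees_upto (d : nat) : seq tree :=
  if d is d'.+1 then
    Leaf :: [seq Node a u.1 u.2 | a <- enum I,
               u <- [seq (l, r) | l <- trees_upto d', r <- trees_upto d']]
  else [:: Leaf].

Lemma mem_trees_upto d t : (nodes t <= d)%N -> t \in trees_upto d.
Proof.
elim: d t => [|d IHd] [|a l r] //= h; rewrite inE; apply/orP; right.
apply/allpairsP; exists (a, (l, r)); split=> //=; first exact: mem_enum.
by apply/allpairsP; exists (l, r); split=> //=; apply: IHd; lia.
Qed.

Definition ntree_enum : seq ntree := pmap insub (undup (trees_upto n)).

Lemma ntree_enumP : Finite.axiom ntree_enum.
Proof.
apply: Finite.uniq_enumP => [|t].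
  exact/pmap_sub_uniq/undup_uniq.
rewrite mem_pmap_sub mem_undup inE; apply/mem_trees_upto.
by case: t => t /= /eqP ->.
Qed.
HB.instance Definition _ := isFinite.Build ntree ntree_enumP.

End FixedSize.

Lemma nodes_ntree n (t : ntree n) : nodes t = n.
Proof. by case: t => t /= /eqP. Qed.

Fact ngraft_subproof m n p (e : (m + n)%N = p) i (s : ntree m) (t : ntree n) :
  nodes (graft s i t) == p.
Proof. by rewrite nodes_graft !nodes_ntree e. Qed.

Definition ngraft m n p (e : (m + n)%N = p) (i : 'I_m.+1)
    (s : ntree m) (t : ntree n) : ntree p := NTree (ngraft_subproof e i s t).

Definition nleaf : ntree 0 := @NTree 0 Leaf (eqxx _).
Definition corolla (a : I) : ntree 1 := @NTree 1 (Node a Leaf Leaf) (eqxx _).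

End Trees.

Section Quadratic.
Variable k : fieldType.

(* The free non-symmetric operad on the space k^I placed in arity 2: its
   component of arity n+1 has for basis the trees with n nodes. *)
Section Free.
Variable I : finType.

Local Notation F n := {ffun ntree I n -> k^o}.

Definition free_id : F 0 := single (nleaf I) (1 : k^o).

Definition free_comp m n p (e : (m + n)%N = p) (i : 'I_m.+1) :
    F m -> F n -> F p :=
  bext (ngraft e i) (fun _ _ (a b : k^o) => a * b : k^o).

Let mul_bilinear : bilinear_map (fun a b : k^o => a * b : k^o).
Proof.
split=> [b c a a' | a c b b'] /=; first by rewrite mulrDl scalerAl.
by rewrite mulrDr scalerAr.
Qed.

Fact free_comp_bilinear m n p (e : (m + n)%N = p) i :
  bilinear_map (free_comp e i).
Proof. exact: bext_bilinear. Qed.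

Lemma free_comp_single m n p (e : (m + n)%N = p) i s t (a b : k^o) :
  free_comp e i (single s a) (single t b) =
  single (ngraft e i s t) (a * b : k^o).
Proof. by rewrite /free_comp bext_single. Qed.

Let B0l m n p e i := bilinear_map0l (@free_comp_bilinear m n p e i).
Let B0r m n p e i := bilinear_map0r (@free_comp_bilinear m n p e i).
Let BDl m n p e i := bilinear_mapDl (@free_comp_bilinear m n p e i).
Let BDr m n p e i := bilinear_mapDr (@free_comp_bilinear m n p e i).

Fact free_compA m n p q r u (e1 : (m + n)%N = p) (e2 : (p + q)%N = r)
    (e3 : (n + q)%N = u) (e4 : (m + u)%N = r)
    (i : 'I_m.+1) (j : 'I_n.+1) (l : 'I_p.+1) (x : F m) (y : F n) (z : F q) :
  l = (i + j)%N :> nat ->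
  free_comp e2 l (free_comp e1 i x y) z =
  free_comp e4 i x (free_comp e3 j y z).
Proof.
move=> le.
elim/single_ind: x => [|x x' IHx IHx'|s a]; first by rewrite !B0l.
  by rewrite !BDl IHx IHx'.
elim/single_ind: y => [|y y' IHx IHx'|t b]; first by rewrite !(B0l, B0r).
  by rewrite !(BDl, BDr) IHx IHx'.
elim/single_ind: z => [|z z' IHx IHx'|v c]; first by rewrite !B0r.
  by rewrite !BDr IHx IHx'.
rewrite !free_comp_single mulrA; congr single.
by apply/val_inj; rewrite /= le graft_seq // nodes_ntree -ltnS.
Qed.

Fact free_compC m n p q r u (e1 : (m + n)%N = p) (e2 : (p + q)%N = r)
    (e3 : (m + q)%N = u) (e4 : (u + n)%N = r)
    (i i' : 'I_m.+1) (l : 'I_p.+1) (l' : 'I_u.+1) (x : F m) (y : F n) (z : F q) :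
  (i < i')%N -> l = (i' + n)%N :> nat -> l' = i :> nat ->
  free_comp e2 l (free_comp e1 i x y) z =
  free_comp e4 l' (free_comp e3 i' x z) y.
Proof.
move=> lt le le'.
elim/single_ind: x => [|x x' IHx IHx'|s a]; first by rewrite !B0l.
  by rewrite !BDl IHx IHx'.
elim/single_ind: y => [|y y' IHx IHx'|t b]; first by rewrite !(B0l, B0r).
  by rewrite !(BDl, BDr) IHx IHx'.
elim/single_ind: z => [|z z' IHx IHx'|v c]; first by rewrite !(B0l, B0r).
  by rewrite !(BDl, BDr) IHx IHx'.
rewrite !free_comp_single mulrAC; congr single.
apply/val_inj; rewrite /= le le'.
have := @graft_par I s i i' t v lt; rewrite !nodes_ntree; apply.
by rewrite -ltnS.
Qed.

Fact free_id_comp n (e : (0 + n)%N = n) i (x : F n) :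
  free_comp e i free_id x = x.
Proof.
elim/single_ind: x => [|x x' IHx IHx'|s a]; first by rewrite B0r.
  by rewrite BDr IHx IHx'.
by rewrite free_comp_single mul1r; congr single; apply/val_inj.
Qed.

Fact free_comp_id n (e : (n + 0)%N = n) i (x : F n) :
  free_comp e i x free_id = x.
Proof.
elim/single_ind: x => [|x x' IHx IHx'|s a]; first by rewrite B0l.
  by rewrite BDl IHx IHx'.
rewrite free_comp_single mulr1; congr single.
by apply/val_inj; rewrite /= graft_leaf.
Qed.

Definition free_nsoperad : nsoperad k :=
  @NsOperad k (fun n => F n : lmodType k) free_id free_comp free_comp_bilinear free_compA free_compC
    free_id_comp free_comp_id.

Definition free_gen (a : I) : free_nsoperad 1%N := single (corolla a) (1 : k^o).

End Free.

(* Coordinates on F(V')(3), V' = k^I, in the basis of the mu o_c nu: the basis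
   element indexed by (c, mu, nu) is mu o_1 nu if c = 0, mu o_2 nu if c = 1. *)
Definition free3 (I : finType) := {ffun 'I_2 * I * I -> k^o}.

Definition free3_mon (I : finType) (c : 'I_2) (mu nu : I) : free3 I :=
  single (c, mu, nu) (1 : k^o).

Definition free3_elt (I : finType) (r : free3 I) : free_nsoperad I 2%N :=
  \sum_c \sum_mu \sum_nu r (c, mu, nu) *:
    op_comp (erefl : (1 + 1)%N = 2) c (free_gen mu) (free_gen nu).

Record quadratic := Quadratic {
  q_gen : finType;
  q_rel : {vspace free3 q_gen}
}.

Inductive relator (D : quadratic) : forall n, free_nsoperad (q_gen D) n -> Prop :=
  Relator r of r \in q_rel D : relator (free3_elt r).

Definition ns_presented (D : quadratic) : nsoperad k :=
  quotient_nsoperad (gen_ideal_ideal (@relator D)).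

Definition presented (D : quadratic) : operad k :=
  regular_operad (ns_presented D).

(* The dual of V' = k^I is identified with k^I by means of the dual basis; the
   pairing between F(V')(3) and F(dual V')(3) is expressed in coordinates. *)
Definition pairing (I : finType) (x y : free3 I) : k^o :=
  \sum_(t : 'I_2 * I * I) (-1) ^+ t.1.1 * (x t * y t).

Fact pairing_linear (I : finType) (x : free3 I) : linear (pairing x).
Proof.
move=> c y z; rewrite /pairing scaler_sumr -big_split; apply: eq_bigr => t _ /=.
rewrite !ffunE !mulrDr; congr (_ + _).
by rewrite -[c *: y t]/(c * y t) (mulrCA (x t)) (mulrCA _ c).
Qed.
HB.instance Definition _ (I : finType) (x : free3 I) :=
  GRing.isLinear.Build k (free3 I) k^o _ (pairing x) (pairing_linear x).

Lemma pairingC (I : finType) (x y : free3 I) : pairing x y = pairing y x.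
Proof. by apply: eq_bigr => t _; rewrite [x t * _]mulrC. Qed.

Definition orthogonal (I : finType) (R : {vspace free3 I}) : {vspace free3 I} :=
  (\bigcap_(i < \dim R) lker (linfun (pairing (vbasis R)`_i)))%VS.

Lemma orthogonalP (I : finType) (R : {vspace free3 I}) y :
  reflect (forall x, x \in R -> pairing x y = 0) (y \in orthogonal R).
Proof.
have basisP i : (<[y]> <= lker (linfun (pairing (vbasis R)`_i)))%VS
    = (pairing (vbasis R)`_i y == 0).
  by rewrite -memvE memv_ker lfunE.
rewrite memvE; apply: (iffP subv_bigcapP) => [yR x xR | yR i _].
  rewrite (coord_vbasis xR) pairingC linear_sum /= big1 // => i _.
  rewrite linearZ /= pairingC; have := yR i isT; rewrite basisP => /eqP ->.
  by rewrite scaler0.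
by rewrite basisP yR // vbasis_mem // mem_nth // size_tuple.
Qed.

Lemma orthogonal_span (I : finType) (X : seq (free3 I)) y :
  reflect (forall x, x \in X -> pairing x y = 0) (y \in orthogonal <<X>>%VS).
Proof.
apply: (iffP (orthogonalP _ _)) => [yX x xX | yX x xX]; first exact/yX/memv_span.
rewrite (coord_span (X := in_tuple X) xX) pairingC linear_sum /= big1 // => i _.
rewrite linearZ /= pairingC yX ?scaler0 // mem_nth //.
Qed.

Lemma pairing_mon (I : finType) (c : 'I_2) (mu nu : I) (y : free3 I) :
  pairing (free3_mon c mu nu) y = (-1) ^+ c * y (c, mu, nu).
Proof.
rewrite /pairing (bigD1 (c, mu, nu)) //= big1 ?addr0 => [|t ne].
  by rewrite ffunE eqxx mul1r.
by rewrite ffunE (negbTE ne) mul0r mulr0.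
Qed.

Definition koszul_dual (D : quadratic) : quadratic :=
  Quadratic (orthogonal (q_rel D)).

(* Manin products.  Functions on pairs of basis indices are coordinates on
   F(V')(3) (x) F(W')(3). *)
Section Products.
Variables I J : finType.

Definition free33 := {ffun ('I_2 * I * I) * ('I_2 * J * J) -> k^o}.

Definition tens (x : free3 I) (y : free3 J) : free33 :=
  [ffun u => x u.1 * y u.2].

Definition tensv (U : {vspace free3 I}) (W : {vspace free3 J}) : {vspace free33} :=
  <<[seq tens x y | x <- vbasis U, y <- vbasis W]>>%VS.

Definition Phi (x : free3 (I * J)%type) : free33 :=
  [ffun u => if u.1.1.1 == u.2.1.1
             then x (u.1.1.1, (u.1.1.2, u.2.1.2), (u.1.2, u.2.2)) else 0].

Definition Psi (z : free33) : free3 (I * J)%type :=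
  [ffun t : 'I_2 * (I * J) * (I * J) => (-1) ^+ t.1.1 *
    z ((t.1.1, t.1.2.1, t.2.1), (t.1.1, t.1.2.2, t.2.2))].

Fact Phi_linear : linear Phi.
Proof.
by move=> c x y; apply/ffunP => u; rewrite !ffunE; case: ifP;
   rewrite ?scaler0 ?addr0.
Qed.
HB.instance Definition _ :=
  GRing.isLinear.Build k (free3 (I * J)%type) free33 _ Phi Phi_linear.

Fact Psi_linear : linear Psi.
Proof.
move=> c x y; apply/ffunP => t; rewrite !ffunE mulrDr; congr (_ + _).
exact: mulrCA.
Qed.
HB.instance Definition _ :=
  GRing.isLinear.Build k free33 (free3 (I * J)%type) _ Psi Psi_linear.

End Products.

Definition white_product (D E : quadratic) : quadratic :=
  Quadratic (linfun (@Phi (q_gen D) (q_gen E)) @^-1: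
    (tensv (q_rel D) fullv + tensv fullv (q_rel E)))%VS.

Definition black_product (D E : quadratic) : quadratic :=
  Quadratic (linfun (@Psi (q_gen D) (q_gen E)) @:
    tensv (q_rel D) (q_rel E))%VS.

End Quadratic.

Arguments free3_mon {k I} c mu nu.

Section Examples.
Variable k : fieldType.

Local Notation o1 mu nu := (free3_mon (k := k) (ord0 : 'I_2) mu nu).
Local Notation o2 mu nu := (free3_mon (k := k) (ord_max : 'I_2) mu nu).

Local Notation l := false.
Local Notation r := true.

(* l is the operation x < y and r the operation x > y *)
Definition Dend : quadratic k := @Quadratic k bool
  <<[:: o1 l l - o2 l l - o2 l r;
        o1 l r - o2 r l;
        o1 r l + o1 r r - o2 r r]>>%VS.

(* l is the operation x -| y and r the operation x |- y *)
Definition Dias : quadratic k := @Quadratic k bool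
  <<[:: o1 l l - o2 l l;
        o1 l l - o2 l r;
        o1 l r - o2 r l;
        o1 r l - o1 r r;
        o1 r l - o2 r r]>>%VS.

Let subE (x y : free3 k bool) t : (x - y) t = x t - y t.
Proof. by rewrite !ffunE. Qed.
Let addE (x y : free3 k bool) t : (x + y) t = x t + y t.
Proof. by rewrite !ffunE. Qed.
Let scaleE c (y : free3 k bool) t : (c *: y) t = c * y t.
Proof. by rewrite !ffunE. Qed.
Let o1E (m n : bool) c' m' n' : o1 m n (c', m', n') = ((c' == ord0) && (m' == m) && (n' == n))%:R.
Proof. by rewrite ffunE !xpair_eqE; case: ifP. Qed.
Let o2E (m n : bool) c' m' n' : o2 m n (c', m', n') = ((c' == ord_max) && (m' == m) && (n' == n))%:R.
Proof. by rewrite ffunE !xpair_eqE; case: ifP. Qed.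

Lemma orthogonal_Dend (y : free3 k bool) :
  y \in orthogonal (q_rel Dend) <->
    [/\ y (ord0, l, l) + y (ord_max, l, l) + y (ord_max, l, r) = 0,
        y (ord0, l, r) + y (ord_max, r, l) = 0
      & y (ord0, r, l) + y (ord0, r, r) + y (ord_max, r, r) = 0].
Proof.
have pB (x z : free3 k bool) : pairing (x - z) y = pairing x y - pairing z y.
  by rewrite !(pairingC _ y) linearB.
have pD (x z : free3 k bool) : pairing (x + z) y = pairing x y + pairing z y.
  by rewrite !(pairingC _ y) linearD.
have p1 m n : pairing (o1 m n) y = y (ord0, m, n).
  by rewrite pairing_mon expr0 mul1r.
have p2 m n : pairing (o2 m n) y = - y (ord_max, m, n).
  by rewrite pairing_mon expr1 mulN1r.
have all3 (T : eqType) (Q : T -> Prop) (a b c : T) :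
    (forall x, x \in [:: a; b; c] -> Q x) <-> [/\ Q a, Q b & Q c].
  split=> [H | [Ha Hb Hc] x].
    by split; apply: H; rewrite !inE eqxx ?orbT.
  by rewrite !inE => /or3P[] /eqP ->.
have E1 : pairing (o1 l l - o2 l l - o2 l r) y =
    y (ord0, l, l) + y (ord_max, l, l) + y (ord_max, l, r).
  by rewrite pB pB p1 p2 p2 !opprK.
have E2 : pairing (o1 l r - o2 r l) y = y (ord0, l, r) + y (ord_max, r, l).
  by rewrite pB p1 p2 opprK.
have E3 : pairing (o1 r l + o1 r r - o2 r r) y =
    y (ord0, r, l) + y (ord0, r, r) + y (ord_max, r, r).
  by rewrite pB pD p1 p1 p2 opprK.
rewrite -E1 -E2 -E3 -(all3 _ (fun x => pairing x y = 0)).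
by split=> [/orthogonal_span|H]; last exact/orthogonal_span.
Qed.

Let combE (u1 u2 u3 u4 u5 : k) (f1 f2 f3 f4 f5 f6 f7 f8 : free3 k bool) t :
  (u1 *: (f1 - f2) + u2 *: (f1 - f3) + u3 *: (f4 - f5) + u4 *: (f6 - f7)
    + u5 *: (f6 - f8)) t =
  u1 * (f1 t - f2 t) + u2 * (f1 t - f3 t) + u3 * (f4 t - f5 t)
    + u4 * (f6 t - f7 t) + u5 * (f6 t - f8 t).
Proof. by rewrite addE addE addE addE !scaleE !subE. Qed.

Lemma Dias_decomp (y : free3 k bool) :
  y (ord0, l, l) + y (ord_max, l, l) + y (ord_max, l, r) = 0 ->
  y (ord0, l, r) + y (ord_max, r, l) = 0 ->
  y (ord0, r, l) + y (ord0, r, r) + y (ord_max, r, r) = 0 ->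
  y = (- y (ord_max, l, l)) *: (o1 l l - o2 l l)
      + (- y (ord_max, l, r)) *: (o1 l l - o2 l r)
      + (- y (ord_max, r, l)) *: (o1 l r - o2 r l)
      + (- y (ord0, r, r)) *: (o1 r l - o1 r r)
      + (- y (ord_max, r, r)) *: (o1 r l - o2 r r).
Proof.
move=> e1 e2 e3; apply/ffunP; case=> [[c m] n].
rewrite [RHS]combE !(o1E l l, o1E l r, o1E r l, o1E r r, o2E l l, o2E l r, o2E r l, o2E r r).
have [->|->] : c = ord0 \/ c = ord_max.
  by case: c => [[|[|//]] ?]; [left|right]; apply/val_inj.
all: case: m; case: n; rewrite /= ?(mulr0, mulr1, subrr, sub0r, subr0, addr0, add0r, mulrN, opprK, mulrN1).
all: try by [].
all: apply/eqP.
- by rewrite -opprD -addr_eq0 addrA e3.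
- by rewrite -addr_eq0 e2.
- by rewrite -opprD -addr_eq0 addrA e1.
Qed.

Let orth_sub (f g : free3 k bool) :
  f (ord0, l, l) - g (ord0, l, l) + (f (ord_max, l, l) - g (ord_max, l, l))
    + (f (ord_max, l, r) - g (ord_max, l, r)) = 0 ->
  f (ord0, l, r) - g (ord0, l, r) + (f (ord_max, r, l) - g (ord_max, r, l)) = 0 ->
  f (ord0, r, l) - g (ord0, r, l) + (f (ord0, r, r) - g (ord0, r, r))
    + (f (ord_max, r, r) - g (ord_max, r, r)) = 0 ->
  f - g \in orthogonal (q_rel Dend).
Proof. by move=> e1 e2 e3; apply/orthogonal_Dend; rewrite !subE. Qed.

Lemma koszul_dual_Dend : koszul_dual Dend = Dias.
Proof.
have span5 (W : vectType k) (a b c d e : W) (u1 u2 u3 u4 u5 : k) :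
    u1 *: a + u2 *: b + u3 *: c + u4 *: d + u5 *: e
      \in <<[:: a; b; c; d; e]>>%VS.
  by rewrite !memvD // memvZ // memv_span // !inE eqxx ?orbT.
have all5 (W : vectType k) (U : {vspace W}) (a b c d e : W) :
    a \in U -> b \in U -> c \in U -> d \in U -> e \in U ->
    (<<[:: a; b; c; d; e]>> <= U)%VS.
  move=> Ha Hb Hc Hd He; apply/span_subvP => x.
  by rewrite !inE => /orP[|/or4P[]] /eqP ->.
suff E : orthogonal (q_rel Dend) = q_rel Dias.
  by rewrite /koszul_dual E.
apply/eqP; rewrite eqEsubv; apply/andP; split.
  apply/subvP => y /orthogonal_Dend[e1 e2 e3].
  by rewrite (Dias_decomp e1 e2 e3); apply: span5.
apply: all5; apply: orth_sub.
all: by rewrite !(o1E l l, o1E l r, o1E r l, o1E r r, o2E l l, o2E l r, o2E r l, o2E r r)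
  /= ?(subrr, sub0r, subr0, addr0, add0r, addNr, addrN).
Qed.

Definition As : quadratic k := @Quadratic k unit <[o1 tt tt - o2 tt tt]>%VS.

Definition Quad : quadratic k := black_product Dend Dend.

End Examples.

(* Main.v *)
From HB Require Import structures.
From mathcomp Require Import all_boot all_algebra all_fingroup.
From mathcomp Require Import zify.
Require Import Defs.

(** The three operads are linearisations of one combinatorial object.

    Label the nodes of a binary tree by functions K -> {left, right}.  For each
    j in K, walking up from the root and turning at every node as the label
    says for j ends at one leaf, so that a tree with labels points at a family
    of leaves indexed by K.  For K with one element the labels are the two
    operations of Dias, for K empty there is the single operation of As, and
    for K with two elements the labels are the four operations of
    Dias [] Dias.  In each case the quadratic relations say precisely that two
    compositions of two operations are equal as soon as they point at the same
    leaves ([pointing_relations]).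

    These relations suffice to identify any two trees of the same size that
    point at the same leaves ([tree_eqv_pointed]): a tree is rotated into the
    form Node a Leaf r; the label a is then known, because in direction j it
    turns left exactly when the leaf pointed at is the first one; and in the
    directions in which a turns left the first label of r can be changed at
    will, which reduces the comparison to the subtrees r.  Conversely the
    relations preserve the leaves, and every family of leaves is pointed at by
    some tree.  So the component of arity n of the non-symmetric operad has the
    functions K -> {1, ..., n} for basis, and grafting trees composes these
    functions by the rule of Perm at each j ([presented_ns_basis]).

    In the regular operad a basis element is a pair of such a function f and a
    permutation s feeding the inputs to the leaves.  Sending (f, s) to s (f j)
    for one chosen j, together with (f without j, s), is a bijection that turns
    the rule of composition into that of a product with Perm
    ([regular_power_basis]): each element of K contributes one Hadamard factor
    Perm.  Operads with bases composed and permuted by the same tables are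
    isomorphic ([basis_isomorphic]).

    The relations of the Koszul dual of Quad are found as follows.  The
    relations of Dend are the signed sums of all the compositions that point at
    a given leaf; [Psi] multiplies the signed sums for two leaves into the one
    for the pair of leaves; and being orthogonal to it means that the
    coefficients of the compositions pointing at this pair sum to zero
    ([koszul_dual_black_pointing]).  That this dual is Dias [] Dias is the
    general fact that Koszul duality exchanges the black and the white product
    ([koszul_dual_black]): [Psi] is adjoint to [Phi], and the annihilator of
    R (x) S is R^perp (x) F + F (x) S^perp ([annihilator_tensv]). *)

Set Implicit Arguments.
Unset Strict Implicit.
Unset Printing Implicit Defensive.

Import GRing.Theory.
Local Open Scope ring_scope.

(** * Duality between the black and the white product *)

Section Orthogonality.
Variable k : fieldType.

Lemma span_linear_eq0 (V : vectType k) (f : {linear V -> k^o}) (X : seq V) :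
  (forall x, x \in X -> f x = 0) -> forall x, x \in <<X>>%VS -> f x = 0.
Proof.
move=> fX x xX; rewrite (coord_span (X := in_tuple X) xX) linear_sum /= big1 // => i _.
by rewrite linearZ /= fX ?scaler0 // mem_nth.
Qed.

Lemma tens_suml (I J T : finType) (a : T -> k) (x : T -> free3 k I) (y : free3 k J) :
  tens (\sum_i a i *: x i) y = \sum_i a i *: tens (x i) y.
Proof.
apply/ffunP => u; rewrite ffunE !sum_ffunE mulr_suml.
by apply: eq_bigr => i _; rewrite !ffunE -mulrA.
Qed.

Lemma tens_sumr (I J T : finType) (a : T -> k) (x : free3 k I) (y : T -> free3 k J) :
  tens x (\sum_i a i *: y i) = \sum_i a i *: tens x (y i).
Proof.
apply/ffunP => u; rewrite ffunE !sum_ffunE mulr_sumr.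
by apply: eq_bigr => i _; rewrite !ffunE mulrCA.
Qed.

Lemma tens_span (I J : finType) (X : seq (free3 k I)) (Y : seq (free3 k J)) x y :
  x \in <<X>>%VS -> y \in <<Y>>%VS ->
  tens x y \in <<[seq tens x y | x <- X, y <- Y]>>%VS.
Proof.
move=> xX yY; rewrite (coord_span (X := in_tuple X) xX) (coord_span (X := in_tuple Y) yY).
rewrite tens_suml; apply: memv_suml => i _; apply: memvZ; rewrite tens_sumr.
apply: memv_suml => j _; apply/memvZ/memv_span.
by apply: allpairs_f; apply: mem_nth.
Qed.

Lemma mem_tens (I J : finType) (U : {vspace free3 k I}) (W : {vspace free3 k J}) x y :
  x \in U -> y \in W -> tens x y \in tensv U W.
Proof.
by rewrite -{1}(span_basis (vbasisP U)) -{1}(span_basis (vbasisP W)); apply: tens_span.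
Qed.

Section Pairing2.
Variables I J : finType.

(** The tensor product of the pairings on [free3 k I] and [free3 k J]. *)
Definition pairing2 (z z' : free33 k I J) : k^o :=
  \sum_(u : ('I_2 * I * I) * ('I_2 * J * J))
    (-1) ^+ u.1.1.1 * (-1) ^+ u.2.1.1 * (z u * z' u).

Fact pairing2_linear z : linear (pairing2 z).
Proof.
move=> c y y'; rewrite /pairing2 scaler_sumr -big_split; apply: eq_bigr => t _ /=.
rewrite !ffunE !mulrDr; congr (_ + _).
by rewrite -[c *: y t]/(c * y t) (mulrCA (z t)) (mulrCA _ c).
Qed.
HB.instance Definition _ z :=
  GRing.isLinear.Build k (free33 k I J) k^o _ (pairing2 z) (pairing2_linear z).

Lemma pairing2_tens x y x' y' :
  pairing2 (tens x y) (tens x' y') = pairing x x' * pairing y y' :> k.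
Proof.
rewrite /pairing mulr_suml.
under [RHS]eq_bigr do rewrite mulr_sumr.
rewrite pair_big; apply: eq_bigr => -[m m'] _ /=; rewrite !ffunE /=.
rewrite [RHS]mulrACA; congr (_ * _); exact: mulrACA.
Qed.

(** Both maps only see the pairs of compositions made at the same input, where
    the two signs of [pairing2] cancel, as do those of [Psi] and [pairing]. *)
Lemma pairing_Psi z y : pairing (Psi z) y = pairing2 z (Phi y).
Proof.
pose h (t : 'I_2 * (I * J) * (I * J)) : ('I_2 * I * I) * ('I_2 * J * J) :=
  ((t.1.1, t.1.2.1, t.2.1), (t.1.1, t.1.2.2, t.2.2)).
pose h' (u : ('I_2 * I * I) * ('I_2 * J * J)) : 'I_2 * (I * J) * (I * J) :=
  (u.1.1.1, (u.1.1.2, u.2.1.2), (u.1.2, u.2.2)).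
rewrite /pairing2 (bigID (fun u : ('I_2 * I * I) * ('I_2 * J * J) => u.1.1.1 == u.2.1.1)) /=.
rewrite [X in _ = _ + X]big1 ?addr0; last first.
  by move=> u /negbTE ne; rewrite !ffunE ne !mulr0.
rewrite (reindex_onto h h') /=; last first.
  by case=> [[[c a] b] [[c' a'] b']] /= /eqP <-.
apply: eq_big => [[[c [a a']] [b b']]|[[c [a a']] [b b']] _].
  by rewrite /= !eqxx.
by rewrite !ffunE /= eqxx !mulrA.
Qed.

End Pairing2.

Lemma orthogonal_PsiP (I J : finType) (R : {vspace free3 k I}) (S : {vspace free3 k J}) y :
  y \in orthogonal (linfun (@Psi k I J) @: tensv R S)%VS <->
  forall x x', x \in R -> x' \in S -> pairing (Psi (tens x x')) y = 0.
Proof.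
split=> [/orthogonalP yo x x' xR x'S | yo].
  by rewrite -[Psi _](lfunE (@Psi k I J)); apply/yo/memv_img/mem_tens.
rewrite limg_span; apply/orthogonal_span => _ /mapP[_ /allpairsP[[x x'] /= [xR x'S ->]] ->].
by rewrite lfunE; apply: yo; apply: vbasis_mem.
Qed.

Lemma pairing_mon_id (I : finType) (t : 'I_2 * I * I) (y : free3 k I) :
  pairing (free3_mon t.1.1 t.1.2 t.2) y = (-1) ^+ t.1.1 * y t.
Proof. by rewrite pairing_mon -!surjective_pairing. Qed.

Section Adjoint.
Variables (I : finType) (f : 'End(free3 k I)).

Definition adjoint (y : free3 k I) : free3 k I :=
  [ffun t : 'I_2 * I * I => (-1) ^+ t.1.1 * pairing (f (free3_mon t.1.1 t.1.2 t.2)) y].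

Lemma free3_decomp (x : free3 k I) : x = \sum_t x t *: free3_mon t.1.1 t.1.2 t.2.
Proof.
apply/ffunP => t; rewrite sum_ffunE (bigD1 t) //= big1 => [|u ne].
  by rewrite !ffunE -!surjective_pairing eqxx addr0 [_ *: _]mulr1.
by rewrite !ffunE -!surjective_pairing eq_sym (negbTE ne) scaler0.
Qed.

Lemma pairing_adjoint x y : pairing x (adjoint y) = pairing (f x) y.
Proof.
rewrite (free3_decomp x) [RHS]pairingC !linear_sum /= [LHS]pairingC linear_sum.
apply: eq_bigr => t _; rewrite !linearZ /= ; congr (_ *: _).
rewrite pairingC pairing_mon_id ffunE mulrA -expr2 sqrr_sign mul1r.
exact: pairingC.
Qed.

End Adjoint.

(** A projection onto R is the identity on R, so its adjoint does not change
    the values of [pairing x] for x in R. *)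
Lemma sub_adjoint_orthogonal (I : finType) (R : {vspace free3 k I}) y :
  y - adjoint (projv R) y \in orthogonal R.
Proof.
apply/orthogonalP => x xR; rewrite linearB /= pairing_adjoint projv_id //.
exact: subrr.
Qed.

Lemma free33_decomp (I J : finType) (z : free33 k I J) :
  z = \sum_u z u *: tens (free3_mon u.1.1.1 u.1.1.2 u.1.2)
                         (free3_mon u.2.1.1 u.2.1.2 u.2.2).
Proof.
apply/ffunP => u; rewrite sum_ffunE (bigD1 u) //= big1 => [|v ne].
  by rewrite !ffunE -!surjective_pairing !eqxx addr0 mulr1 [_ *: _]mulr1.
rewrite !ffunE -!surjective_pairing.
have : u != v by rewrite eq_sym.
case: u v {ne} => [u u'] [v v']; rewrite xpair_eqE negb_and /=.
by case/orP => /negbTE ->; rewrite ?mul0r ?mulr0 scaler0.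
Qed.

(** With projections onto R and S, and p and q their adjoints, the identity is
    (1 - p) (x) 1 + p (x) (1 - q) + p (x) q.  The first two maps have their
    images in the two summands by [sub_adjoint_orthogonal], and p (x) q is the
    adjoint of a map with image in R (x) S, so it kills the annihilator of
    R (x) S. *)
Lemma annihilator_tensv (I J : finType) (R : {vspace free3 k I}) (S : {vspace free3 k J}) z :
  z \in (tensv (orthogonal R) fullv + tensv fullv (orthogonal S))%VS <->
  forall x y, x \in R -> y \in S -> pairing2 (tens x y) z = 0.
Proof.
split=> [/memv_addP[u uR [v vS ->]] x y xR yS | z0].
  rewrite linearD /=; set U := (X in X + _); set V := (X in _ + X).
  have -> : U = 0.
    apply: (span_linear_eq0 (f := pairing2 (tens x y))) uR.
    move=> _ /allpairsP[[a b] /= [aR _ ->]].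
    rewrite pairing2_tens; move/vbasis_mem/orthogonalP: aR => /(_ _ xR) ->.
    exact: mul0r.
  have -> : V = 0.
    apply: (span_linear_eq0 (f := pairing2 (tens x y))) vS.
    move=> _ /allpairsP[[a b] /= [_ bS ->]].
    rewrite pairing2_tens; move/vbasis_mem/orthogonalP: bS => /(_ _ yS) ->.
    exact: mulr0.
  exact: addr0.
pose p := adjoint (projv R); pose q := adjoint (projv S).
pose e (u : ('I_2 * I * I) * ('I_2 * J * J)) : free3 k I := free3_mon u.1.1.1 u.1.1.2 u.1.2.
pose e' (u : ('I_2 * I * I) * ('I_2 * J * J)) : free3 k J := free3_mon u.2.1.1 u.2.1.2 u.2.2.
have pq0 : \sum_u z u *: tens (p (e u)) (q (e' u)) = 0.
  apply/ffunP => -[s t]; rewrite sum_ffunE !ffunE.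
  set x := projv R (free3_mon s.1.1 s.1.2 s.2).
  set y := projv S (free3_mon t.1.1 t.1.2 t.2).
  transitivity ((-1) ^+ s.1.1 * (-1) ^+ t.1.1 * pairing2 (tens x y) z : k).
    rewrite [in RHS](free33_decomp z) linear_sum mulr_sumr.
    apply: eq_bigr => u _; rewrite linearZ /= !ffunE pairing2_tens /=.
    rewrite [RHS]mulrCA -[LHS]/(z u * _); congr (_ * _); exact: mulrACA.
  by rewrite (z0 x y) ?mulr0 // memv_proj.
have -> : z = \sum_u z u *: (tens (e u - p (e u)) (e' u))
    + \sum_u z u *: tens (p (e u)) (e' u - q (e' u)).
  transitivity (\sum_u z u *: tens (e u) (e' u)); first exact: free33_decomp.
  rewrite -[LHS]subr0 -[X in _ - X]pq0 -sumrB -big_split.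
  apply: eq_bigr => u _ /=; rewrite -scalerBr -scalerDr; congr (_ *: _).
  by apply/ffunP => v; rewrite !ffunE mulrBl mulrBr addrA subrK.
apply: memv_add; apply: memv_suml => u _; apply: memvZ; apply: mem_tens;
  by rewrite ?memvf ?sub_adjoint_orthogonal.
Qed.

(** By adjunction, y is orthogonal to the relations of the black product when
    [Phi y] annihilates the tensor product of the two spaces of relations. *)
Lemma koszul_dual_black (D E : quadratic k) :
  koszul_dual (black_product D E) = white_product (koszul_dual D) (koszul_dual E).
Proof.
congr Quadratic; apply/vspaceP => y; apply/idP/idP.
  move/orthogonal_PsiP => yo; rewrite -memv_preim lfunE; apply/annihilator_tensv.
  by move=> x x' xR x'S; rewrite -pairing_Psi yo.
rewrite -memv_preim lfunE => /annihilator_tensv yo; apply/orthogonal_PsiP => x x' xR x'S.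
by rewrite pairing_Psi; apply: yo.
Qed.

End Orthogonality.

(** * Operads with a basis that is closed under composition *)

(** The structure constants of an operad in a basis that is closed under
    composition and under the action; the axioms they obey are those of the
    operad, read on the basis. *)
Record ns_table := NsTable {
  nst_elt :> nat -> finType;
  nst_id : nst_elt 0;
  nst_comp : forall m n p, (m + n)%N = p -> 'I_m.+1 ->
    nst_elt m -> nst_elt n -> nst_elt p
}.

Record table := Table {
  tab_ns :> ns_table;
  tab_act : forall n, tab_ns n -> 'S_n.+1 -> tab_ns n
}.

Definition perm_table : table :=
  @Table (@NsTable (fun n => 'I_n.+1 : finType) ord0 (fun m n p _ i l j => slot p i l j))
    (fun n l s => s l).

Definition prod_table (X Y : table) : table :=
  @Table (@NsTable (fun n => (X n * Y n)%type : finType) (nst_id X, nst_id Y)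
            (fun m n p e i x y => (nst_comp e i x.1 y.1, nst_comp e i x.2 y.2)))
    (fun n x s => (tab_act x.1 s, tab_act x.2 s)).

(** The rule of [reg_comp]: input i of (y, s) is slot s^-1 i of y. *)
Definition regular_table (X : ns_table) : table :=
  @Table (@NsTable (fun n => (X n * 'S_n.+1)%type : finType) (nst_id X, 1%g)
            (fun m n p e i x y => (nst_comp e ((x.2^-1)%g i) x.1 y.1,
                                   perm_comp e ((x.2^-1)%g i) x.2 y.2)))
    (fun n x s => (x.1, (x.2 * s)%g)).

Definition power_table (K : finType) : ns_table :=
  @NsTable (fun n => {ffun K -> 'I_n.+1} : finType) [ffun=> ord0]
    (fun m n p e i x y => [ffun j => slot p i (x j) (y j)]).

Section Bases.
Variable k : fieldType.

(** The coordinates are part of the data, as the components of an operad are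
    bare modules, without a [vectType] structure to compute them from. *)
Record basis (V : lmodType k) (X : finType) := Basis {
  vec : X -> V;
  coords : {linear V -> {ffun X -> k^o}};
  coords_vec : forall x, coords (vec x) = single x (1 : k^o);
  coordsK : forall v, v = \sum_x (coords v x : k) *: vec x
}.

Record ns_basis (P : nsoperad k) (X : ns_table) := NsBasis {
  nsb :> forall n, basis (P n) (X n);
  nsb_id : vec (nsb 0) (nst_id X) = op_id P;
  nsb_comp : forall m n p (e : (m + n)%N = p) i x y,
    vec (nsb p) (nst_comp e i x y) = op_comp e i (vec (nsb m) x) (vec (nsb n) y)
}.

Record op_basis (P : operad k) (X : table) := OpBasis {
  opb :> ns_basis P X;
  opb_act : forall n x s, vec (opb n) (tab_act x s) = op_act (vec (opb n) x) s
}.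

Section Transfer.
Variables (X : finType) (V W : lmodType k) (b : basis V X) (c : basis W X).

Definition transfer (v : V) : W := \sum_x (coords b v x : k) *: vec c x.

Fact transfer_linear : linear transfer.
Proof.
move=> a u v; rewrite /transfer scaler_sumr -big_split; apply: eq_bigr => x _ /=.
by rewrite linearP !ffunE scalerDl scalerA.
Qed.
HB.instance Definition _ := GRing.isLinear.Build k V W _ transfer transfer_linear.

Lemma transfer_vec x : transfer (vec b x) = vec c x.
Proof.
rewrite /transfer coords_vec (bigD1 x) //= big1 => [|y ne].
  by rewrite ffunE eqxx scale1r addr0.
by rewrite ffunE (negbTE ne) scale0r.
Qed.

End Transfer.

Lemma transferK (X : finType) (V W : lmodType k) (b : basis V X) (c : basis W X) :
  cancel (transfer b c) (transfer c b).
Proof.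
move=> v; rewrite [RHS](coordsK b) [X in transfer c b X]/transfer linear_sum.
by apply: eq_bigr => x _; rewrite linearZ /= transfer_vec.
Qed.

Section BilinearSums.
Variables (L M N : lmodType k) (g : M -> N -> L) (bg : bilinear_map g).
Variables (T : finType) (c : T -> k).

Lemma bilinear_suml u v : g (\sum_t c t *: u t) v = \sum_t c t *: g (u t) v.
Proof.
elim/big_rec2: _ => [|t y1 y2 _ <-]; first exact: bilinear_map0l.
by rewrite bilinear_mapDl // bilinear_mapZl.
Qed.

Lemma bilinear_sumr u v : g u (\sum_t c t *: v t) = \sum_t c t *: g u (v t).
Proof.
elim/big_rec2: _ => [|t y1 y2 _ <-]; first exact: bilinear_map0r.
by rewrite bilinear_mapDr // bilinear_mapZr.
Qed.

End BilinearSums.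

Lemma op_act_sum (O : operad k) n (s : 'S_n.+1) (T : finType) (c : T -> k) (u : T -> O n) :
  op_act (\sum_t c t *: u t) s = \sum_t c t *: op_act (u t) s.
Proof.
have L := op_act_linear (o := O) s.
have L0 : op_act (0 : O n) s = 0.
  by have := L (-1) 0 0; rewrite scaler0 addr0 scaleN1r addNr.
by elim/big_rec2: _ => // t y1 y2 _ <-; rewrite L.
Qed.

(** The linear map that matches the two bases commutes with composition and with
    the permutations of inputs because it does so on basis vectors. *)
Lemma basis_isomorphic (P Q : operad k) (X : table) :
  op_basis P X -> op_basis Q X -> operad_isomorphic P Q.
Proof.
move=> bP bQ; pose f n : {linear P n -> Q n} := transfer (bP n) (bQ n).
have f_vec n x : f n (vec (bP n) x) = vec (bQ n) x by apply: transfer_vec.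
exists f; split.
- by move=> n; exists (transfer (bQ n) (bP n)); apply: transferK.
- by rewrite -(nsb_id bP) f_vec nsb_id.
- move=> m n p e i a b.
  have BP := op_comp_bilinear P e i; have BQ := op_comp_bilinear Q e i.
  have fE q (v : P q) : f q v = \sum_x (coords (bP q) v x : k) *: vec (bQ q) x by [].
  rewrite {1}(coordsK (bP m) a) {1}(coordsK (bP n) b) [f m a]fE [f n b]fE.
  rewrite (bilinear_suml BP) (bilinear_suml BQ) linear_sum.
  apply: eq_bigr => x _; rewrite linearZ /=; congr (_ *: _).
  rewrite (bilinear_sumr BP) (bilinear_sumr BQ) linear_sum.
  apply: eq_bigr => y _; rewrite linearZ /=; congr (_ *: _).
  by rewrite -nsb_comp !f_vec nsb_comp.
- move=> n a s; rewrite {1}(coordsK (bP n) a) op_act_sum linear_sum.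
  rewrite -[f n a]/(\sum_x (coords (bP n) a x : k) *: vec (bQ n) x) op_act_sum.
  apply: eq_bigr => x _; rewrite linearZ /=; congr (_ *: _).
  by rewrite -opb_act !f_vec opb_act.
Qed.

Lemma single_scale (X : finType) (x : X) (a : k^o) : single x a = a *: single x (1 : k^o).
Proof. by apply/ffunP => u; rewrite !ffunE; case: ifP => _; rewrite ?scaler0 ?[_ *: _]mulr1. Qed.

Section Reindex.
Variables (P : operad k) (X Y : table) (b : op_basis P X).
Variables (h : forall n, X n -> Y n) (h' : forall n, Y n -> X n).
Hypotheses (hK : forall n, cancel (@h n) (@h' n)) (h'K : forall n, cancel (@h' n) (@h n)).
Hypothesis h_id : h (nst_id X) = nst_id Y.
Hypothesis h_comp : forall m n p (e : (m + n)%N = p) i x y,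
  h (nst_comp e i x y) = nst_comp e i (h x) (h y).
Hypothesis h_act : forall n (x : X n) s, h (tab_act x s) = tab_act (h x) s.

Definition reindex_coords n (v : P n) : {ffun Y n -> k^o} :=
  [ffun y => coords (b n) v (h' y)].

Fact reindex_coords_linear n : linear (@reindex_coords n).
Proof. by move=> c u v; apply/ffunP => y; rewrite ffunE linearP !ffunE. Qed.
HB.instance Definition _ n := GRing.isLinear.Build k (P n) {ffun Y n -> k^o} _
  (@reindex_coords n) (@reindex_coords_linear n).

Definition reindex_basis n : basis (P n) (Y n).
Proof.
apply: (@Basis _ _ (fun y => vec (b n) (h' y)) (@reindex_coords n)) => [y | v].
  apply/ffunP => y'; rewrite !ffunE coords_vec ffunE.
  by rewrite (can_eq (@h'K n)).
rewrite {1}(coordsK (b n) v) (reindex (@h' n)) /=; last first.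
  by exists (@h n) => y _; [apply: h'K | apply: hK].
by apply: eq_bigr => y _; rewrite ffunE.
Defined.

Definition reindex_ns_basis : ns_basis P Y.
Proof.
apply: (@NsBasis _ _ reindex_basis) => [|m n p e i x y] /=.
  by rewrite -h_id hK nsb_id.
by rewrite -nsb_comp -{1}[x]h'K -{1}[y]h'K -h_comp hK.
Defined.

Definition reindex_op_basis : op_basis P Y.
Proof.
apply: (@OpBasis _ _ reindex_ns_basis) => n x s /=.
by rewrite -opb_act -{1}[x]h'K -h_act hK.
Defined.

End Reindex.

Definition perm_basis n : basis (Perm_operad k n) 'I_n.+1.
Proof.
apply: (@Basis _ _ (fun x => single x (1 : k^o)) idfun) => //= v.
by rewrite {1}(single_sum v); apply: eq_bigr => x _; apply: single_scale.
Defined.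

Definition perm_ns_basis : ns_basis (Perm_operad k) perm_table.
Proof.
apply: (@NsBasis (Perm_operad k) perm_table perm_basis) => //= m n p e i x y.
by rewrite perm_op_comp_single mulr1.
Defined.

Definition perm_op_basis : op_basis (Perm_operad k) perm_table.
Proof.
by apply: (@OpBasis _ _ perm_ns_basis) => n x s /=; rewrite perm_op_act_single.
Defined.

Section HadamardBasis.
Variables (P Q : operad k) (X Y : table) (b : op_basis P X) (c : op_basis Q Y).

Definition tens_coords n (v : P n) (w : Q n) : {ffun X n * Y n -> k^o} :=
  [ffun x => coords (b n) v x.1 * coords (c n) w x.2].

Fact tens_coords_bilinear n : bilinear_map (@tens_coords n).
Proof.
split=> [w a v v' | v a w w']; apply/ffunP => x; rewrite !ffunE linearP !ffunE.
  by rewrite mulrDl -scalerAl.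
by rewrite mulrDr -scalerAr.
Qed.
HB.instance Definition _ n := GRing.isLinear.Build k (tensor (P n) (Q n)) {ffun X n * Y n -> k^o} _
  (tlift (@tens_coords n)) (tlift_linear (@tens_coords_bilinear n)).

Definition hadamard_basis n : basis (hadamard P Q n) (X n * Y n)%type.
Proof.
apply: (@Basis _ _ (fun x => tpure (vec (b n) x.1) (vec (c n) x.2)) (tlift (@tens_coords n))).
  move=> x; rewrite /= tlift_pure; last exact: tens_coords_bilinear.
  apply/ffunP => y; rewrite !ffunE !coords_vec !ffunE.
  by case: x y => [x x'] [y y'] /=; rewrite xpair_eqE; do 2!case: eqP;
    rewrite ?(mulr1, mul0r, mulr0).
elim/tensor_ind => [|u v IHu IHv|v w].
- by rewrite big1 // => x _; rewrite linear0 ffunE scale0r.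
- rewrite {1}IHu {1}IHv -big_split; apply: eq_bigr => x _ /=.
  by rewrite linearD ffunE scalerDl.
- rewrite /= tlift_pure; last exact: tens_coords_bilinear.
  rewrite {1}(coordsK (b n) v) (bilinear_suml (tpure_bilinear _ _)).
  rewrite {1}(coordsK (c n) w).
  under [LHS]eq_bigr do rewrite (bilinear_sumr (tpure_bilinear _ _)) scaler_sumr.
  rewrite pair_big; apply: eq_bigr => x _ /=.
  by rewrite scalerA ffunE.
Defined.

Definition hadamard_ns_basis : ns_basis (hadamard P Q) (prod_table X Y).
Proof.
apply: (@NsBasis (hadamard P Q) (prod_table X Y) hadamard_basis) => /= [|m n p e i x y].
  by rewrite !nsb_id.
by rewrite hadamard_comp_pure !nsb_comp.
Defined.

Definition hadamard_op_basis : op_basis (hadamard P Q) (prod_table X Y).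
Proof.
apply: (@OpBasis _ _ hadamard_ns_basis) => n x s /=.
by rewrite hadamard_act_pure !opb_act.
Defined.

End HadamardBasis.

Section RegularBasis.
Variables (P : nsoperad k) (X : ns_table) (b : ns_basis P X).

Definition regular_coords n (v : {ffun 'S_n.+1 -> P n}) : {ffun X n * 'S_n.+1 -> k^o} :=
  [ffun x => coords (b n) (v x.2) x.1].

Fact regular_coords_linear n : linear (@regular_coords n).
Proof. by move=> c u v; apply/ffunP => y; rewrite !ffunE linearP !ffunE. Qed.
HB.instance Definition _ n :=
  GRing.isLinear.Build k {ffun 'S_n.+1 -> P n} {ffun X n * 'S_n.+1 -> k^o} _
  (@regular_coords n) (@regular_coords_linear n).

Definition regular_basis n : basis (regular_operad P n) (X n * 'S_n.+1)%type.
Proof.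
apply: (@Basis _ _ (fun x => single x.2 (vec (b n) x.1)) (@regular_coords n)).
  case=> x s; apply/ffunP => -[y t]; rewrite !ffunE /= xpair_eqE andbC.
  by case: eqP => _; rewrite ?coords_vec ?linear0 ffunE.
move=> v; apply/ffunP => s; rewrite sum_ffunE.
rewrite {1}(coordsK (b n) (v s)).
pose u x := coords (b n) (v s) x *: vec (b n) x.
rewrite (eq_bigr (fun x => if x.2 == s then u x.1 else 0)); last first.
  by move=> [x t] _ /=; rewrite !ffunE /= eq_sym; case: eqP => [->|_]; rewrite ?scaler0.
rewrite -(pair_big predT predT (fun x t => if t == s then u x else 0)) /=.
by apply: eq_bigr => x _; rewrite -big_mkcond big_pred1_eq.
Defined.

Definition regular_ns_basis : ns_basis (regular_operad P) (regular_table X).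
Proof.
apply: (@NsBasis (regular_operad P) (regular_table X) regular_basis) => /= [|m n p e i x y].
  by rewrite nsb_id.
by rewrite reg_comp_single nsb_comp.
Defined.

Definition regular_op_basis : op_basis (regular_operad P) (regular_table X).
Proof.
by apply: (@OpBasis _ _ regular_ns_basis) => n x s /=; rewrite reg_act_single.
Defined.

End RegularBasis.

(** A pair (f, s) describes an operation whose slot l receives input s l and which
    points at the slots f j.  Recording the input s (f j) instead of the
    slot f j, for j = o None, is what makes this coordinate permuted by the
    action, as in Perm. *)
Section RegularPower.
Variables (K L : finType) (o : option K -> L) (o' : L -> option K).
Hypotheses (oK : cancel o o') (o'K : cancel o' o).

Local Notation X := (regular_table (power_table L)).
Local Notation Y := (prod_table perm_table (regular_table (power_table K))).

Let h n (x : X n) : Y n := (x.2 (x.1 (o None)), ([ffun j => x.1 (o (Some j))], x.2)).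
Let h' n (y : Y n) : X n :=
  ([ffun l => if o' l is Some j then y.2.1 j else (y.2.2^-1)%g y.1], y.2.2).

Definition regular_power_basis (P : operad k) : op_basis P X -> op_basis P Y.
Proof.
move=> b; apply: (@reindex_op_basis P X Y b h h').
- move=> n [x s]; rewrite /h /h' /=; congr (_, _); apply/ffunP => l; rewrite ffunE permK.
  by case E: (o' l) => [j|]; rewrite ?ffunE -E o'K.
- move=> n [i [x s]]; rewrite /h /h' /= !ffunE !oK permKV; congr (_, (_, _)).
  by apply/ffunP => j; rewrite !ffunE oK.
- rewrite /h /= perm1 !ffunE; congr (_, (_, _)); by apply/ffunP => j; rewrite !ffunE.
- move=> m n p e i [x s] [y t]; rewrite /h /= !ffunE; congr (_, (_, _)).
    by rewrite perm_compE permKV.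
  by apply/ffunP => j; rewrite !ffunE.
- by move=> n [x s] t; rewrite /h /= permM.
Defined.

End RegularPower.

End Bases.

(** * Leaves pointed at by labelled trees *)

Section Target.
Variable I : finType.
Implicit Types (d : pred I) (s t : tree I).

(** The leaf reached from the root by turning right at the nodes with label in d
    and left at the others; leaves are numbered as for [graft]. *)
Fixpoint target d t : nat :=
  if t is Node a l r then
    if d a then (nodes l + target d r).+1 else target d l
  else 0.

Lemma target_le d t : (target d t <= nodes t)%N.
Proof. by elim: t => //= a l IHl r IHr; case: (d a); lia. Qed.

(** Walking in the grafted tree follows s, and enters t when the leaf reached is
    the one that t replaces: this is the rule of [slot]. *)
Lemma target_graft d s i t : (i <= nodes s)%N ->
  target d (graft s i t) =
    (if target d s == i then i + target d t
     else if (target d s < i)%N then target d s else target d s + nodes t)%N.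
Proof.
elim: s i => [|a l IHl r IHr] i /=.
  by rewrite leqn0 => /eqP ->.
have [hl hr] := (target_le d l, target_le d r).
case: (leqP i (nodes l)) => hi his /=; case: (d a).
- by rewrite nodes_graft; repeat case: ifP; lia.
- by rewrite IHl //; repeat case: ifP; lia.
- by rewrite IHr; last lia; repeat case: ifP; lia.
- by repeat case: ifP; lia.
Qed.

End Target.

Definition tri_tree (I : finType) (m : 'I_2 * I * I) : ntree I 2 :=
  ngraft (erefl : (1 + 1)%N = 2) m.1.1 (corolla m.1.2) (corolla m.2).

(** A node labelled a turns right in direction j when [dir a j], else left. *)
Section Pointing.
Variables (I K : finType) (dir : I -> {ffun K -> bool}).

Definition pointed n (t : ntree I n) : {ffun K -> 'I_n.+1} :=
  [ffun j => inord (target (fun a => dir a j) t)].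

Lemma pointedE n (t : ntree I n) j :
  pointed t j = target (fun a => dir a j) t :> nat.
Proof. by rewrite ffunE inordK // ltnS -[X in (_ <= X)%N](nodes_ntree t) target_le. Qed.

Lemma pointed_comp m n p (e : (m + n)%N = p) i (s : ntree I m) (t : ntree I n) :
  pointed (ngraft e i s t) = @nst_comp (power_table K) _ _ _ e i (pointed s) (pointed t).
Proof.
apply/ffunP => j; apply/val_inj; rewrite [LHS]pointedE /= ffunE slotE // -val_eqE.
by rewrite /= !pointedE target_graft ?nodes_ntree // -ltnS.
Qed.

Lemma pointed_tri (m : 'I_2 * I * I) j :
  pointed (tri_tree m) j = (if m.1.1 == ord0
    then if dir m.1.2 j then 2 else dir m.2 j
    else if dir m.1.2 j then (dir m.2 j).+1 else 0)%N :> nat.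
Proof.
rewrite pointedE; case: m => [[[[|[|//]] hc] a] b] /=; case: (dir a j) => //;
 by case: (dir b j).
Qed.

(** The root turns left in the directions where the first leaf is wanted, and
    the right subtree is found by induction. *)
Lemma target_surj (dir_bij : bijective dir) n (w : K -> nat) :
  (forall j, w j <= n)%N ->
  exists2 t, nodes t = n & forall j, target (fun a => dir a j) t = w j.
Proof.
have [dir' _ dirK] := dir_bij; elim: n w => [|n IHn] w wn.
  by exists (Leaf I) => // j; apply/esym/eqP; rewrite -leqn0.
have [j|r rn rw] := IHn (fun j => (w j).-1); first by have := wn j; lia.
exists (Node (dir' [ffun j => 0 < w j]%N) (Leaf I) r) => [|j]; first by rewrite /= rn.
by rewrite /= dirK ffunE rw; case: (w j).
Qed.

Lemma pointed_surj (dir_bij : bijective dir) n w : exists t, pointed (n := n) t == w.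
Proof.
have [j|t tn tw] := @target_surj dir_bij n (fun j => nat_of_ord (w j)).
  by rewrite -ltnS.
exists (NTree (introT eqP tn)); apply/eqP/ffunP => j; apply/val_inj.
by rewrite /= pointedE tw.
Qed.

End Pointing.

Section Presentation.
Variables (k : fieldType) (K : finType) (D : quadratic k).
Local Notation I := (q_gen D).
Variable dir : I -> {ffun K -> bool}.
Hypothesis dir_bij : bijective dir.

(** The relations are the kernel of the linear map that sends a composition of
    two generators to the family of leaves it points at. *)
Definition pointing_relations := forall r : free3 k I,
  r \in q_rel D <->
  forall w, \sum_(m | pointed dir (tri_tree m) == w) r m = 0.

Hypothesis relD : pointing_relations.

Local Notation F := (free_nsoperad k I).
Local Notation R := (@relator k D).

(** The basis vector of the tree t if it has n nodes, and 0 otherwise; the free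
    index n avoids transports along equalities of numbers of nodes. *)
Definition tree_op n (t : tree I) : F n := [ffun u => (val u == t)%:R].

Lemma tree_op_single n (t : ntree I n) : single t (1 : k^o) = tree_op n t.
Proof. by apply/ffunP => u; rewrite !ffunE val_eqE; case: eqP. Qed.

Lemma tree_op_comp m n p (e : (m + n)%N = p) i s t : nodes s = m -> nodes t = n ->
  op_comp e i (tree_op m s) (tree_op n t) = tree_op p (graft s i t).
Proof.
move=> sm tn; pose s' := NTree (introT eqP sm); pose t' := NTree (introT eqP tn).
rewrite -[s]/(val s') -[t]/(val t') -!tree_op_single [LHS]free_comp_single mulr1.
by rewrite -(tree_op_single (ngraft e i s' t')).
Qed.

Lemma free3_eltE (r : free3 k I) : free3_elt r = \sum_m (r m : k) *: tree_op 2 (tri_tree m).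
Proof.
rewrite /free3_elt pair_big pair_big; apply: eq_bigr => -[[c a] b] _ /=; congr (_ *: _).
by rewrite /free_gen [LHS]free_comp_single mulr1 tree_op_single.
Qed.

(** The sizes are included because [tree_op n] vanishes on trees of other sizes. *)
Definition tree_eqv n (s t : tree I) :=
  [/\ nodes s = n, nodes t = n & gen_ideal R (tree_op n s - tree_op n t)].

Let idR := gen_ideal_ideal R.

Lemma tree_eqv_refl n t : nodes t = n -> tree_eqv n t t.
Proof. by split=> //; rewrite subrr; apply: (ideal_sub idR n).1. Qed.

Lemma tree_eqv_sym n s t : tree_eqv n s t -> tree_eqv n t s.
Proof.
case=> sn tn st; split=> //; rewrite -opprB -scaleN1r -[X in gen_ideal _ X]addr0.
by apply: (ideal_sub idR n).2 => //; apply: (ideal_sub idR n).1.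
Qed.

Lemma tree_eqv_trans n s t u : tree_eqv n s t -> tree_eqv n t u -> tree_eqv n s u.
Proof.
case=> sn tn st [_ un tu]; split=> //; rewrite -(subrKA (tree_op n t)).
by rewrite -[X in X + _]scale1r; apply: (ideal_sub idR n).2.
Qed.

Lemma tree_eqv_graftl m n i s s' t : (i <= m)%N -> nodes t = n ->
  tree_eqv m s s' -> tree_eqv (m + n) (graft s i t) (graft s' i t).
Proof.
rewrite -ltnS => im tn [sm s'm ss']; split; rewrite ?nodes_graft ?sm ?s'm ?tn //.
rewrite -!(tree_op_comp erefl (Ordinal im)) //.
have b := op_comp_bilinear F (erefl : (m + n)%N = _) (Ordinal im).
rewrite -(bilinear_mapNl b) -(bilinear_mapDl b).
exact: (ideal_compl idR).
Qed.

Lemma tree_eqv_graftr m n i s t t' : (i <= m)%N -> nodes s = m ->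
  tree_eqv n t t' -> tree_eqv (m + n) (graft s i t) (graft s i t').
Proof.
rewrite -ltnS => im sm [tn t'n tt']; split; rewrite ?nodes_graft ?sm ?t'n ?tn //.
rewrite -!(tree_op_comp erefl (Ordinal im)) //.
have b := op_comp_bilinear F (erefl : (m + n)%N = _) (Ordinal im).
rewrite -(bilinear_mapNr b) -(bilinear_mapDr b).
exact: (ideal_compr idR).
Qed.

(** The subtrees of a tree are grafted onto its root. *)
Lemma tree_eqv_node m n a l l' r r' : tree_eqv m l l' -> tree_eqv n r r' ->
  tree_eqv (m + n).+1 (Node a l r) (Node a l' r').
Proof.
move=> ll' rr'; have [[lm _ _] [_ r'n _]] := (ll', rr').
have rr := @tree_eqv_graftr 1 n 1 (Node a (Leaf I) (Leaf I)) r r' isT erefl rr'.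
have := tree_eqv_graftl (i := 0) isT lm rr.
rewrite /= addnC addnS => H; apply: (tree_eqv_trans H).
have := @tree_eqv_graftr n.+1 m 0 (Node a (Leaf I) r') l l' isT (congr1 S r'n) ll'.
by rewrite /= addnC addnS.
Qed.

(** The difference of two monomials lies in the kernel that defines the
    relations. *)
Lemma tree_eqv_tri m m' : pointed dir (tri_tree m) = pointed dir (tri_tree m') ->
  tree_eqv 2 (tri_tree m) (tri_tree m').
Proof.
move=> mm'; split; try exact: nodes_ntree.
pose r : free3 k I := single m (1 : k^o) - single m' (1 : k^o).
have -> : tree_op 2 (tri_tree m) - tree_op 2 (tri_tree m') = free3_elt r.
  have E q : tree_op 2 (tri_tree q) =
      \sum_u (single q (1 : k^o) u : k) *: tree_op 2 (tri_tree u).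
    rewrite (bigD1 q) //= big1 ?addr0 => [|u /negbTE ne]; rewrite ffunE ?ne ?scale0r //.
    by rewrite eqxx scale1r.
  rewrite free3_eltE (E m) (E m') -sumrB; apply: eq_bigr => u _.
  have -> : r u = (single m (1 : k^o) u : k) - single m' (1 : k^o) u by rewrite /r !ffunE.
  by rewrite scalerBl.
move=> J idJ RJ; apply/RJ/Relator/relD => w.
have S q : \sum_(u | pointed dir (tri_tree u) == w) single q (1 : k^o) u =
    (pointed dir (tri_tree q) == w)%:R.
  rewrite big_mkcond (bigD1 q) //= big1 ?addr0 => [|u /negbTE ne].
    by rewrite [single _ _ _]ffunE eqxx; case: ifP.
  by rewrite [single _ _ _]ffunE ne if_same.
under eq_bigr do rewrite /r ffunE [X in _ + X]ffunE.
by rewrite sumrB !S mm' subrr.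
Qed.

Lemma tree_eqv_subst m m' x y z n :
  pointed dir (tri_tree m) = pointed dir (tri_tree m') ->
  (nodes x + nodes y + nodes z).+2 = n ->
  tree_eqv n (graft (graft (graft (tri_tree m) 2 z) 1 y) 0 x)
             (graft (graft (graft (tri_tree m') 2 z) 1 y) 0 x).
Proof.
move=> /tree_eqv_tri mm' <-.
have H2 := tree_eqv_graftl (i := 2) (leqnn 2) (erefl (nodes z)) mm'.
have H1 := tree_eqv_graftl (i := 1) (isT : 1 <= 2 + nodes z)%N (erefl (nodes y)) H2.
have := tree_eqv_graftl (i := 0) (leq0n _) (erefl (nodes x)) H1.
by congr tree_eqv; lia.
Qed.

(** In direction j the left tree leads to x if a and b both turn left, to y if b
    turns left and a right, to z if b turns right.  The right tree leads to the
    same subtree when c turns right as soon as one of a, b does, and d = b. *)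
Lemma tree_eqv_rot a b x y z n : (nodes x + nodes y + nodes z).+2 = n ->
  exists c d, tree_eqv n (Node b (Node a x y) z) (Node c x (Node d y z)).
Proof.
have [dir' _ dirK] := dir_bij => xyz.
exists (dir' [ffun j => dir b j || dir a j]), b.
apply: (tree_eqv_subst (m := (ord0, b, a)) (m' := (ord_max, _, b)) _ xyz).
apply/ffunP => j; apply/val_inj; rewrite /= !pointed_tri /= dirK ffunE.
by case: (dir a j); case: (dir b j).
Qed.

(** The label of an inner node is only met in the directions in which the root
    turns towards it. *)
Lemma tree_eqv_inner a b b' x y z n : (nodes x + nodes y + nodes z).+2 = n ->
  (forall j, dir a j -> dir b j = dir b' j) ->
  tree_eqv n (Node a x (Node b y z)) (Node a x (Node b' y z)).
Proof.
move=> xyz bb'.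
apply: (tree_eqv_subst (m := (ord_max, a, b)) (m' := (ord_max, a, b')) _ xyz).
apply/ffunP => j; apply/val_inj; rewrite /= !pointed_tri /=.
by have := bb' j; case: (dir a j) => // ->.
Qed.

(** Each rotation makes the left subtree smaller. *)
Lemma tree_eqv_comb n a l r : (nodes l + nodes r)%N = n ->
  exists b r', tree_eqv n.+1 (Node a l r) (Node b (Leaf I) r').
Proof.
elim: {l}_.+1 {-2}l (ltnSn (nodes l)) a r => // h IHh [|c x y] lh a r lr.
  by exists a, r; apply: tree_eqv_refl; rewrite /= -lr.
move: lr lh => /= lr lh.
have [|d [d' rot]] := @tree_eqv_rot c a x y r n.+1; first lia.
have [||b [r' xb]] := IHh x _ d (Node d' y r); [lia | rewrite /=; lia |].
by exists b, r'; apply: tree_eqv_trans rot xb.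
Qed.

Section Push.
Variable n : nat.

Definition push (x : F n) : {ffun {ffun K -> 'I_n.+1} -> k^o} :=
  [ffun w => \sum_(t | pointed dir t == w) x t].

Fact push_linear : linear push.
Proof.
move=> c x y; apply/ffunP => w; rewrite !ffunE scaler_sumr -big_split.
by apply: eq_bigr => t _; rewrite !ffunE.
Qed.
HB.instance Definition _ :=
  GRing.isLinear.Build k (F n) {ffun {ffun K -> 'I_n.+1} -> k^o} _ push push_linear.

Lemma push_single t c : push (single t c) = single (pointed dir t) c.
Proof.
apply/ffunP => w; rewrite [LHS]ffunE [RHS]ffunE big_mkcond (bigD1 t) //= big1 ?addr0.
  by rewrite [single _ _ _]ffunE eqxx eq_sym.
by move=> u /negbTE ne; rewrite [single _ _ _]ffunE ne if_same.
Qed.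

End Push.

Let mul_bilinear : bilinear_map (fun a b : k^o => a * b : k^o).
Proof.
split=> [b c a a' | a c b b'] /=; first by rewrite mulrDl scalerAl.
by rewrite mulrDr scalerAr.
Qed.

Lemma push_comp m n p (e : (m + n)%N = p) i (x : F m) (y : F n) :
  push (op_comp e i x y) =
  bext (@nst_comp (power_table K) _ _ _ e i) (fun _ _ (a b : k^o) => a * b : k^o)
    (push x) (push y).
Proof.
have b1 := op_comp_bilinear F e i.
have b2 := bext_bilinear (@nst_comp (power_table K) _ _ _ e i) (fun _ _ => mul_bilinear).
elim/single_ind: x => [|x x' IHx IHx'|s a].
- by rewrite (bilinear_map0l b1) !linear0 (bilinear_map0l b2).
- by rewrite (bilinear_mapDl b1) !linearD /= (bilinear_mapDl b2) IHx IHx'.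
elim/single_ind: y => [|y y' IHy IHy'|t b].
- by rewrite (bilinear_map0r b1) !linear0 (bilinear_map0r b2).
- by rewrite (bilinear_mapDr b1) !linearD /= (bilinear_mapDr b2) IHy IHy'.
by rewrite [op_comp _ _ _ _]free_comp_single !push_single bext_single // pointed_comp.
Qed.

(** The kernel of [push] is an ideal by [push_comp], and it contains the
    relators. *)
Lemma push_gen_ideal n x : gen_ideal R x -> push x = 0 :> {ffun {ffun K -> 'I_n.+1} -> k^o}.
Proof.
move=> xR; apply: (xR (fun m y => push y = 0)); last first.
  move=> _ _ [r /relD r0]; rewrite free3_eltE linear_sum.
  apply/ffunP => w; rewrite sum_ffunE [RHS]ffunE -[RHS](r0 w) [RHS]big_mkcond.
  apply: eq_bigr => m _; rewrite linearZ -tree_op_single /= push_single.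
  rewrite [LHS]ffunE [single _ _ _]ffunE eq_sym.
  by case: ifP => _; rewrite ?scaler0 ?[_ *: _]mulr1.
split=> [m|m m' p e i a b a0|m m' p e i a b b0].
- by split=> [|c u v u0 v0]; rewrite ?linear0 // linearP /= u0 v0 scaler0 addr0.
- rewrite push_comp a0; apply: bilinear_map0l.
  exact: (bext_bilinear _ (fun _ _ => mul_bilinear)).
- rewrite push_comp b0; apply: bilinear_map0r.
  exact: (bext_bilinear _ (fun _ _ => mul_bilinear)).
Qed.

(** [push] separates trees that point at different leaves. *)
Lemma tree_eqv_target n s t j : tree_eqv n s t ->
  target (fun a => dir a j) s = target (fun a => dir a j) t.
Proof.
case=> sn tn; pose s' := NTree (introT eqP sn); pose t' := NTree (introT eqP tn).
rewrite -[s]/(val s') -[t]/(val t') -!tree_op_single => /push_gen_ideal.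
rewrite linearB /= !push_single => /eqP; rewrite subr_eq0 => /eqP /ffunP /(_ (pointed dir s')).
rewrite !ffunE eqxx; case: eqP => [st _|_ /eqP]; last by rewrite oner_eq0.
by have := congr1 (fun f : {ffun K -> 'I_n.+1} => val (f j)) st; rewrite /= !pointedE.
Qed.

(** Both trees may be assumed to be of the form Node b Leaf q, with the same b.
    The right subtrees q need not point at the same leaves in the directions
    where b turns left, but there the label of their root is immaterial: it is
    made to turn left too, so that both subtrees point at their first leaf. *)
Lemma tree_eqv_pointed n s t : nodes s = n -> nodes t = n ->
  (forall j, target (fun a => dir a j) s = target (fun a => dir a j) t) ->
  tree_eqv n s t.
Proof.
have [dir' _ dirK] := dir_bij.
elim: n s t => [|n IHn] [|a x r] [|a' x' r'] //=; first by move=> *; apply: tree_eqv_refl.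
case=> xr [xr'] st.
have [b [q eq1]] := tree_eqv_comb a xr; have [b' [q' eq1']] := tree_eqv_comb a' xr'.
have {}st j : target (fun a => dir a j) (Node b (Leaf I) q) =
              target (fun a => dir a j) (Node b' (Leaf I) q').
  by rewrite -(tree_eqv_target j eq1) -(tree_eqv_target j eq1') /= st.
(* In direction j the leaf pointed at is the first one iff b turns left. *)
have bb' : b = b'.
  apply: (bij_inj dir_bij); apply/ffunP => j; have /= := st j.
  by case: (dir b j); case: (dir b' j).
subst b'; apply: (tree_eqv_trans eq1); apply: tree_eqv_sym; apply: (tree_eqv_trans eq1').
have qn : nodes q = n by case: eq1 => _ [].
have qn' : nodes q' = n by case: eq1' => _ [].
move: st qn qn' {IHn eq1 eq1' xr xr'} (IHn) => st.
case: n => [|n] qn qn' IHn.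
  by case: q q' qn qn' st => // -[] // *; apply: tree_eqv_refl.
have norm p : nodes p = n.+1 -> exists c p',
    [/\ nodes p' = n, tree_eqv n.+2 (Node b (Leaf I) p) (Node b (Leaf I) (Node c (Leaf I) p'))
      & forall j, target (fun a => dir a j) (Node c (Leaf I) p') =
          if dir b j then target (fun a => dir a j) p else 0%N].
  case: p => // c y z [yz]; have [d [p' eq2]] := tree_eqv_comb c yz.
  have p'n : nodes p' = n by case: eq2 => _ [].
  exists (dir' [ffun j => dir b j && dir d j]), p'; split=> // [|j].
    apply: (@tree_eqv_trans _ _ (Node b (Leaf I) (Node d (Leaf I) p'))).
      exact: (@tree_eqv_node 0 n.+1 b (Leaf I) _ _ _ (tree_eqv_refl erefl) eq2).
    apply: tree_eqv_inner => [|j bj]; first by rewrite /= p'n.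
    by rewrite dirK ffunE bj.
  by rewrite (tree_eqv_target j eq2) /= dirK ffunE; case: (dir b j).
have [c [p [pn qp tp]]] := norm q qn; have [c' [p' [pn' qp' tp']]] := norm q' qn'.
apply: (tree_eqv_trans qp'); apply: tree_eqv_sym; apply: (tree_eqv_trans qp).
apply: (@tree_eqv_node 0 n.+1 b (Leaf I) _ _ _ (tree_eqv_refl erefl)).
apply: IHn => /= [||j]; rewrite ?pn ?pn' //.
rewrite [LHS]tp [RHS]tp'; have /= := st j.
by case: (dir b j) => // -[].
Qed.

Local Notation pi := (qpi (ideal_sub idR _)).

Definition normal_op n (w : {ffun K -> 'I_n.+1}) : ns_presented D n :=
  pi (single (xchoose (pointed_surj dir_bij w)) (1 : k^o)).

Lemma pi_single n (t : ntree I n) :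
  pi (single t (1 : k^o)) = normal_op (pointed dir t) :> ns_presented D n.
Proof.
apply/qpi_eq; set t' := xchoose _; rewrite !tree_op_single.
have tt' : pointed dir t = pointed dir t' by apply/esym/eqP/(xchooseP (pointed_surj dir_bij _)).
have [] // := @tree_eqv_pointed n t t'; try exact: nodes_ntree.
by move=> j; rewrite -!pointedE tt'.
Qed.

Definition presented_coords n (q : ns_presented D n) : {ffun {ffun K -> 'I_n.+1} -> k^o} :=
  push (qrepr q).

Lemma presented_coords_pi n (x : F n) : presented_coords (pi x : ns_presented D n) = push x.
Proof.
apply/eqP; rewrite -subr_eq0 -linearB; apply/eqP/push_gen_ideal.
exact: (qrepr_pi (ideal_sub idR n)).
Qed.

Fact presented_coords_linear n : linear (@presented_coords n).
Proof.
move=> c; elim/qpi_ind => x; elim/qpi_ind => y.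
by rewrite -qpi_is_linear !presented_coords_pi linearP.
Qed.
HB.instance Definition _ n := GRing.isLinear.Build k (ns_presented D n)
  {ffun {ffun K -> 'I_n.+1} -> k^o} _ (@presented_coords n) (@presented_coords_linear n).

Definition presented_basis n : basis (ns_presented D n) {ffun K -> 'I_n.+1}.
Proof.
apply: (@Basis k _ _ (@normal_op n) (@presented_coords n)) => [w | ].
  rewrite /= presented_coords_pi push_single; congr single.
  exact/eqP/(xchooseP (pointed_surj dir_bij _)).
elim/qpi_ind => x; rewrite /= presented_coords_pi.
rewrite {1}(single_sum x) linear_sum (partition_big (@pointed _ _ dir n) predT) //=.
apply: eq_bigr => w _; rewrite ffunE scaler_suml; apply: eq_bigr => t /eqP <-.
by rewrite single_scale linearZ /= -pi_single.
Defined.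

Definition presented_ns_basis : ns_basis (ns_presented D) (power_table K).
Proof.
apply: (@NsBasis _ _ (power_table K) presented_basis) => /= [|m n p e i x y].
  by rewrite [RHS](pi_single (nleaf I)); congr normal_op; apply/ffunP => j; rewrite !ord1.
rewrite /normal_op [RHS]qop_compE [op_comp _ _ _ _]free_comp_single mulr1 [RHS]pi_single.
congr normal_op; rewrite pointed_comp.
by rewrite !(eqP (xchooseP (pointed_surj dir_bij _))).
Defined.

End Presentation.

(** * The relations of As, Dend and the dual of Quad *)

Section Duals.
Variable k : fieldType.

Section Relator.
Variables (I K : finType) (dir : I -> {ffun K -> bool}).

(** The sign is that of the pairing, so that pairing with it sums the
    coefficients of the compositions pointing at w. *)
Definition pointing_relator (w : {ffun K -> 'I_3}) : free3 k I :=
  [ffun m => if pointed dir (tri_tree m) == w then (-1) ^+ m.1.1 else 0].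

Definition pointing_relators := [seq pointing_relator w | w : {ffun K -> 'I_3}].

Lemma pairing_pointing w y :
  pairing (pointing_relator w) y = \sum_(m | pointed dir (tri_tree m) == w) y m.
Proof.
rewrite [RHS]big_mkcond; apply: eq_bigr => m _; rewrite [pointing_relator w m]ffunE.
by case: ifP => _; rewrite ?(mul0r, mulr0) // mulrA -expr2 sqrr_sign mul1r.
Qed.

End Relator.

Lemma koszul_dual_pointing (D : quadratic k) (K : finType) (dir : q_gen D -> {ffun K -> bool}) :
  q_rel D = <<pointing_relators dir>>%VS -> @pointing_relations k K (koszul_dual D) dir.
Proof.
move=> DE y; rewrite /= DE; split=> [/orthogonal_span yo w | yo].
  by rewrite -pairing_pointing yo // map_f // mem_enum.
by apply/orthogonal_span => _ /mapP[w _ ->]; rewrite pairing_pointing.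
Qed.

Section Product.
Variables (I J K L : finType) (dir : I -> {ffun K -> bool}) (dir' : J -> {ffun L -> bool}).

Definition dir_prod (a : I * J) : {ffun K + L -> bool} :=
  [ffun j => match j with inl i => dir a.1 i | inr i => dir' a.2 i end].

Lemma dir_prod_bij : bijective dir -> bijective dir' -> bijective dir_prod.
Proof.
move=> [d dK Kd] [d' d'K Kd'].
exists (fun f : {ffun K + L -> bool} => (d [ffun i => f (inl i)], d' [ffun i => f (inr i)])).
  move=> [a b]; congr (_, _).
  - by rewrite -[RHS]dK; congr d; apply/ffunP => i; rewrite !ffunE.
  - by rewrite -[RHS]d'K; congr d'; apply/ffunP => i; rewrite !ffunE.
by move=> f; apply/ffunP => -[i|i]; rewrite ffunE ?Kd ?Kd' ffunE.
Qed.

(** A pair of compositions made at the same input points at a pair of families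
    exactly when each of them does, and the three signs (-1)^c multiply to (-1)^c. *)
Lemma pointing_relator_prod (w : {ffun K + L -> 'I_3}) :
  pointing_relator dir_prod w =
  Psi (tens (pointing_relator dir [ffun i => w (inl i)])
            (pointing_relator dir' [ffun i => w (inr i)])).
Proof.
apply/ffunP => -[[c [a a']] [b b']]; rewrite /Psi [RHS]ffunE /tens [in RHS]ffunE /=.
rewrite /pointing_relator !ffunE -/(pointed _ _) /=.
have E : (pointed dir_prod (tri_tree (c, (a, a'), (b, b'))) == w) =
  (pointed dir (tri_tree (c, a, b)) == [ffun i => w (inl i)]) &&
  (pointed dir' (tri_tree (c, a', b')) == [ffun i => w (inr i)]).
  apply/eqP/andP => [<-|[/eqP /ffunP wl /eqP /ffunP wr]].
    by split; apply/eqP/ffunP => j; apply/val_inj; rewrite /= ffunE !pointed_tri /= !ffunE.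
  apply/ffunP => -[i|i]; [have := wl i | have := wr i]; rewrite [in RHS]ffunE => <-;
    apply/val_inj; by rewrite /= !pointed_tri /= !ffunE.
rewrite E; case: eqP => _; last by rewrite mul0r mulr0.
case: eqP => _; last by rewrite !mulr0.
by rewrite mulrA -expr2 sqrr_sign mul1r.
Qed.

End Product.

Lemma koszul_dual_black_pointing (D E : quadratic k) (K L : finType)
    (dir : q_gen D -> {ffun K -> bool}) (dir' : q_gen E -> {ffun L -> bool}) :
  q_rel D = <<pointing_relators dir>>%VS -> q_rel E = <<pointing_relators dir'>>%VS ->
  @pointing_relations k _ (koszul_dual (black_product D E)) (dir_prod dir dir').
Proof.
move=> DE EE y; split=> [/orthogonal_PsiP yo w | yo].
  rewrite -pairing_pointing pointing_relator_prod; apply: yo.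
    by rewrite DE memv_span // map_f // mem_enum.
  by rewrite EE memv_span // map_f // mem_enum.
apply/orthogonal_PsiP => x x'; rewrite DE EE => xR x'S; rewrite pairingC.
have := tens_span xR x'S; move: (tens x x').
apply: (span_linear_eq0 (f := pairing y \o @Psi k (q_gen D) (q_gen E))).
move=> _ /allpairsP[[u v] /= [/mapP[w _ ->] /mapP[w' _ ->] ->]].
pose w'' : {ffun K + L -> 'I_3} := [ffun j => match j with inl i => w i | inr i => w' i end].
rewrite -[RHS](yo w'') -pairing_pointing pointing_relator_prod /= pairingC.
have -> : [ffun i => w'' (inl i)] = w by apply/ffunP => i; rewrite !ffunE.
by have -> : [ffun i => w'' (inr i)] = w' by apply/ffunP => i; rewrite !ffunE.
Qed.

End Duals.

Section Examples.
Variable k : fieldType.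

Definition bool_dir (a : bool) : {ffun unit -> bool} := [ffun=> a].

Lemma bool_dir_bij : bijective bool_dir.
Proof.
exists (fun f : {ffun unit -> bool} => f tt) => [a|f]; first by rewrite ffunE.
by apply/ffunP => -[]; rewrite ffunE.
Qed.

(** The leaves 0, 1 and 2 give the three relations of Dend in order. *)
Lemma Dend_pointing : q_rel (Dend k) = <<pointing_relators k bool_dir>>%VS.
Proof.
pose o1 := @free3_mon k bool ord0; pose o2 := @free3_mon k bool ord_max.
pose X := [:: o1 false false - o2 false false - o2 false true;
              o1 false true - o2 true false;
              o1 true false + o1 true true - o2 true true].
have rel (i : 'I_3) : pointing_relator k bool_dir [ffun=> i] = X`_i.
  apply/ffunP => -[[c a] b]; rewrite [LHS]ffunE.
  have -> : (pointed bool_dir (tri_tree (c, a, b)) == [ffun=> i]) =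
      ((if c == ord0 then if a then 2 else b : nat else if a then b.+1 else 0)%N == i).
    apply/eqP/eqP => [/ffunP/(_ tt)|ci]; last apply/ffunP => -[].
      by move/(congr1 val); rewrite /= pointed_tri !ffunE => <-.
    by apply/val_inj; rewrite /= pointed_tri !ffunE.
  case: i c => [[|[|[|//]]] hi] [[|[|//]] hc]; case: a; case: b;
    rewrite /= ?ffunE /= ?xpair_eqE -?val_eqE /=;
    by rewrite ?expr0 ?expr1 ?(subr0, sub0r, addr0, add0r, oppr0).
apply/eqP; rewrite eqEsubv; apply/andP; split; apply/span_subvP => x.
  move=> /(nthP 0)[i i3 <-]; have /= <- := rel (Ordinal i3).
  by apply: memv_span; apply: map_f; rewrite mem_enum.
case/mapP => w _ ->; have -> : w = [ffun=> w tt] by apply/ffunP => -[]; rewrite ffunE.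
by rewrite rel; apply: memv_span; apply: mem_nth; apply: ltn_ord.
Qed.

Definition unit_dir (a : unit) : {ffun void -> bool} := [ffun=> true].

Lemma unit_dir_bij : bijective unit_dir.
Proof. by exists (fun _ : {ffun void -> bool} => tt) => [[]|f] //; apply/ffunP => -[]. Qed.

Lemma As_pointing : @pointing_relations k _ (As k) unit_dir.
Proof.
pose m0 : 'I_2 * unit * unit := (ord0, tt, tt); pose m1 : 'I_2 * unit * unit := (ord_max, tt, tt).
have E (m : 'I_2 * unit * unit) : m = m0 \/ m = m1.
  by case: m => [[[[|[|//]] hc] []] []]; [left | right]; congr (_, _, _); apply/val_inj.
have sumE (r : free3 k unit) w : \sum_(m | pointed unit_dir (tri_tree m) == w) r m = r m0 + r m1.
  rewrite (bigD1 m0) /=; last by apply/eqP/ffunP => -[].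
  rewrite (bigD1 m1) /=; last by rewrite andbT; apply/eqP/ffunP => -[].
  by rewrite big1 ?addr0 // => m; case: (E m) => ->; rewrite ?eqxx ?andbF.
move=> r; split=> [/vlineP[c ->] w | r0].
  by rewrite sumE !ffunE /= subr0 sub0r -scalerDr subrr scaler0.
apply/vlineP; exists (r m0); apply/ffunP => m.
have r1 : r m1 = - r m0.
  by apply/eqP; rewrite -addr_eq0 addrC -(sumE r [ffun=> ord0]) r0.
case: (E m) => ->; rewrite !ffunE /=; rewrite ?subr0 ?sub0r ?r1.
  by rewrite [_ *: _]mulr1.
by rewrite [_ *: _]mulrN1.
Qed.

End Examples.

(** * The isomorphisms *)

Section Main.
Variable k : fieldType.

Definition Dias_basis : op_basis (presented (Dias k)) (regular_table (power_table unit)).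
Proof.
rewrite -koszul_dual_Dend; apply/regular_op_basis.
apply/(@presented_ns_basis k _ (koszul_dual (Dend k)) _ bool_dir_bij).
exact/koszul_dual_pointing/Dend_pointing.
Defined.

Definition As_basis : op_basis (presented (As k)) (regular_table (power_table void)).
Proof.
apply/regular_op_basis.
exact: (@presented_ns_basis k _ (As k) _ unit_dir_bij (@As_pointing k)).
Defined.

Definition Quad_dual_basis :
  op_basis (presented (koszul_dual (Quad k))) (regular_table (power_table (unit + unit)%type)).
Proof.
apply/regular_op_basis.
apply/(@presented_ns_basis k _ (koszul_dual (Quad k)) _ (dir_prod_bij bool_dir_bij bool_dir_bij)).
by apply: koszul_dual_black_pointing; apply: Dend_pointing.
Defined.

End Main.

Theorem theorem47 (k : fieldType) (char0 : [pchar k] =i pred0) :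
  [/\ koszul_dual (Quad k) = white_product (Dias k) (Dias k),
      operad_isomorphic (presented (koszul_dual (Quad k)))
        (hadamard (Perm_operad k) (presented (Dias k)))
    & operad_isomorphic (hadamard (Perm_operad k) (presented (Dias k)))
        (hadamard (Perm_operad k)
          (hadamard (Perm_operad k) (presented (As k))))].
Proof.
split; first by rewrite /Quad koszul_dual_black koszul_dual_Dend.
- apply: (basis_isomorphic _ (hadamard_op_basis (perm_op_basis k) (Dias_basis k))).
  (* The first direction of Quad^! becomes the new factor Perm. *)
  apply: (@regular_power_basis _ unit (unit + unit)%type
    (fun j => if j is Some _ then inr tt else inl tt)
    (fun j => if j is inr _ then Some tt else None)); last exact: Quad_dual_basis.
    by case=> [[]|].
  by case=> -[].
- apply: (basis_isomorphic (hadamard_op_basis (perm_op_basis k) _)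
    (hadamard_op_basis (perm_op_basis k) (hadamard_op_basis (perm_op_basis k) (As_basis k)))).
  (* The only direction of Dias becomes the second factor Perm. *)
  apply: (@regular_power_basis _ void unit (fun=> tt) (fun=> None)); last exact: Dias_basis.
    by case=> [[]|].
  by case.
Qed.
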